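(* Let $X\subset\mathbb{P}^1\times\mathbb{P}^1$ be a nonempty finite set of points forming a Ferrers diagram. Then $X$ is a virtual complete intersection if and only if $X$ is a rectangle.
   Context: Let $\Bbbk$ be an algebraically closed field; $\mathbb{P}^1\times\mathbb{P}^1$ is over $\Bbbk$, with projections $\pi_1,\pi_2$ to the first and second factor. A finite set $X\subset\mathbb{P}^1\times\mathbb{P}^1$ forms a Ferrers diagram if one can order $\pi_1(X)=\{a_1,\dots,a_h\}$ and $\pi_2(X)=\{b_1,\dots,b_v\}$ and find integers $\lambda_1\ge\lambda_2\ge\cdots\ge\lambda_v\geq 1$ such that $(a_i,b_j)\in X$ if and only if $i\le\lambda_j$. It is a rectangle if moreover $X=\pi_1(X)\times\pi_2(X)$ (i.e. it consists of all points of a grid). The Cox ring is $S=\Bbbk[x_0,x_1,y_0,y_1]$, $\mathbb{Z}^2$-graded with $\deg x_i=(1,0)$ and $\deg y_i=(0,1)$, and $B=\langle x_0,x_1\rangle\cap\langle y_0,y_1\rangle$ is the irrelevant ideal. A set of points means a reduced zero-dimensional subscheme $X$ of $\mathbb{P}^1\times\mathbb{P}^1$; $I_X\subset S$ is the $B$-saturated bihomogeneous ideal of polynomials vanishing on $X$. A virtual resolution of $S/I$ ($I$ a bihomogeneous ideal) is a $\mathbb{Z}^2$-graded complex of free $S$-modules $F_\bullet=[F_0\xleftarrow{\varphi_1}F_1\xleftarrow{\varphi_2}F_2\leftarrow\cdots]$ such that for every $i\ge 1$ the annihilator of $H_i(F_\bullet)$ contains $B^\ell$ for some $\ell>0$,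 and the sheaves on $\mathbb{P}^1\times\mathbb{P}^1$ associated to $S/I$ and $\operatorname{coker}(\varphi_1)$ are isomorphic. The set $X$ is a virtual complete intersection (VCI) if $S/I_X$ has a virtual resolution that is the Koszul complex $K(f,g)$ of two bihomogeneous forms $f,g\in S$. *)

(* Defs.v *)
From HB Require Import structures.
From mathcomp Require Import all_boot all_order all_algebra.
From mathcomp Require Import finmap mpoly.

Set Implicit Arguments.
Unset Strict Implicit.
Unset Printing Implicit Defensive.

Import GRing.Theory.
Local Open Scope ring_scope.

(* P^1(k): the lines through the origin of k^2. *)
Notation P1 k := {L : {vspace 'rV[k]_2} | \dim L == 1%N}.

(* k[x_0, x_1, y_0, y_1]; the index type 'I_(2 + 2) separates the x's from
   the y's. *)
Notation cox k := {mpoly k[2 + 2]}.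

Section Cox.
Variable k : fieldType.

Definition cox_x (i : 'I_2) : cox k := 'X_(lshift 2 i).
Definition cox_y (j : 'I_2) : cox k := 'X_(rshift 2 j).

Definition bideg (m : 'X_{1..(2 + 2)}) : int * int :=
  ((\sum_(i < 2) m (lshift 2 i))%N%:Z, (\sum_(j < 2) m (rshift 2 j))%N%:Z).

(* Membership in S_d; in particular 0 is bihomogeneous of every bidegree. *)
Definition bihomog (d : int * int) (p : cox k) : Prop :=
  forall m, m \in msupp p -> bideg m = d.

Definition ideal_gen n (g : 'I_n -> cox k) (p : cox k) : Prop :=
  exists c : 'I_n -> cox k, p = \sum_i c i * g i.

Definition ideal_mul (I J : cox k -> Prop) (p : cox k) : Prop :=
  exists n (a b : 'I_n -> cox k),
    [/\ forall i, I (a i), forall i, J (b i) & p = \sum_i a i * b i].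

Fixpoint ideal_exp (I : cox k -> Prop) (l : nat) : cox k -> Prop :=
  if l is l'.+1 then ideal_mul I (ideal_exp I l') else fun=> True.

Definition irrelevant (p : cox k) : Prop :=
  ideal_gen cox_x p /\ ideal_gen cox_y p.

(* Vanishing at all representatives of (L, M). *)
Definition vanish_at (p : cox k) (P : P1 k * P1 k) : Prop :=
  forall u v : 'rV[k]_2, u \in val P.1 -> v \in val P.2 -> u != 0 -> v != 0 ->
  p.@[row_mx u v 0] = 0.

Definition ideal_of (X : {fset P1 k * P1 k}) (p : cox k) : Prop :=
  forall P, P \in X -> vanish_at p P.

(* The Z^2-graded module (\bigoplus_i S e_i) / N, where e_i has degree
   [gm_deg i] and N = [gm_rel] is a graded submodule. *)
Record gmodule := GModule {
  gm_rk : nat;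
  gm_deg : 'I_gm_rk -> int * int;
  gm_rel : 'rV[cox k]_gm_rk -> Prop
}.

Definition gm_homog (M : gmodule) (d : int * int) (m : 'rV[cox k]_(gm_rk M)) :=
  forall i, bihomog (d - gm_deg i) (m 0 i).

Definition quot_ring (I : cox k -> Prop) : gmodule :=
  @GModule 1 (fun=> 0) (fun v => I (v 0 0)).

(* The sheaf associated to M is described on the open sets D(h), for h a form
   whose bidegree has both entries positive: these D(h) are affine and form a
   basis of the topology of P^1 x P^1, stable under intersection, and the
   sections over D(h) are the elements of degree (0, 0) of the localization
   M_h.  The pair (m, t) stands for the fraction m / h^t. *)
Definition basic_open (d : int * int) (h : cox k) : Prop :=
  [/\ bihomog d h, 0 < d.1 & 0 < d.2].

Definition loc_frac (M : gmodule) : Type := ('rV[cox k]_(gm_rk M) * nat)%type.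

Section Sections.
Variable M : gmodule.
Implicit Types (d : int * int) (h q : cox k) (s : loc_frac M).

Definition is_section d s : Prop := gm_homog (d *+ s.2) s.1.

Definition frac_eq h s s' : Prop :=
  exists r : nat, gm_rel (h ^+ r *: (h ^+ s'.2 *: s.1 - h ^+ s.2 *: s'.1)).

Definition frac_add h s s' : loc_frac M :=
  (h ^+ s'.2 *: s.1 + h ^+ s.2 *: s'.1, (s.2 + s'.2)%N).

(* Action of the regular function p / h^t. *)
Definition frac_scale (p : cox k) (t : nat) s : loc_frac M :=
  (p *: s.1, (t + s.2)%N).

(* Restriction from D(h) to D(h q): m / h^t = q^t m / (h q)^t. *)
Definition frac_res q s : loc_frac M := (q ^+ s.2 *: s.1, s.2).

End Sections.

Record is_sheaf_morphism (M N : gmodule) (psi : cox k -> loc_frac M -> loc_frac N) :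
    Prop := IsSheafMorphism {
  sheaf_morph_section : forall d h s,
    basic_open d h -> is_section d s -> is_section d (psi h s);
  sheaf_morph_eq : forall d h s s',
    basic_open d h -> is_section d s -> is_section d s' ->
    frac_eq h s s' -> frac_eq h (psi h s) (psi h s');
  sheaf_morph_add : forall d h s s',
    basic_open d h -> is_section d s -> is_section d s' ->
    frac_eq h (psi h (frac_add h s s')) (frac_add h (psi h s) (psi h s'));
  sheaf_morph_scale : forall d h p t s,
    basic_open d h -> bihomog (d *+ t) p -> is_section d s ->
    frac_eq h (psi h (frac_scale p t s)) (frac_scale p t (psi h s));
  sheaf_morph_res : forall d e h q s,
    basic_open d h -> bihomog e q -> basic_open (d + e) (h * q) ->
    is_section d s ->
    frac_eq (h * q) (psi (h * q) (frac_res q s)) (frac_res q (psi h s))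
}.

Definition sheaf_iso (M N : gmodule) : Prop :=
  exists (psi : cox k -> loc_frac M -> loc_frac N) (phi : cox k -> loc_frac N -> loc_frac M),
    [/\ is_sheaf_morphism psi, is_sheaf_morphism phi,
        forall d h s, basic_open d h -> is_section d s ->
          frac_eq h (phi h (psi h s)) s
      & forall d h s, basic_open d h -> is_section d s ->
          frac_eq h (psi h (phi h s)) s].

(* F_i is free on a basis of size [gc_rk i] in degrees [gc_deg i]; elements of
   F_i are row vectors and the map F_(i+1) -> F_i is v |-> v *m gc_d i. *)
Record gcomplex := GComplex {
  gc_rk : nat -> nat;
  gc_deg : forall i, 'I_(gc_rk i) -> int * int;
  gc_d : forall i, 'M[cox k]_(gc_rk i.+1, gc_rk i);
  gc_d_homog : forall i a b, bihomog (gc_deg a - gc_deg b) (gc_d i a b);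
  gc_dd : forall i, gc_d i.+1 *m gc_d i = 0
}.

Definition coker0 (F : gcomplex) : gmodule :=
  @GModule (gc_rk F 0) (@gc_deg F 0) (fun v => exists w, v = w *m gc_d F 0).

(* b annihilates H_(i+1)(F) *)
Definition annihilates_homology (F : gcomplex) (i : nat) (b : cox k) : Prop :=
  forall z : 'rV[cox k]_(gc_rk F i.+1), z *m gc_d F i = 0 ->
  exists w, b *: z = w *m gc_d F i.+1.

Definition virtual_resolution (F : gcomplex) (I : cox k -> Prop) : Prop :=
  (forall i, exists2 l : nat, (0 < l)%N &
     forall b, ideal_exp irrelevant l b -> annihilates_homology F i b) /\
  sheaf_iso (quot_ring I) (coker0 F).

Section Koszul.
Variables (f g : cox k) (df dg : int * int).
Hypotheses (f_homog : bihomog df f) (g_homog : bihomog dg g).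

Definition koszul_rk (i : nat) : nat :=
  match i with 0 => 1 | 1 => 2 | 2 => 1 | _ => 0 end.

Definition koszul_deg i : 'I_(koszul_rk i) -> int * int :=
  match i with
  | 1 => fun a => if a == 0 :> nat then df else dg
  | 2 => fun=> df + dg
  | _ => fun=> 0
  end.

Definition koszul_d i : 'M[cox k]_(koszul_rk i.+1, koszul_rk i) :=
  match i with
  | 0 => \matrix_(a < 2, b < 1) if a == 0 :> nat then f else g
  | 1 => \matrix_(a < 1, b < 2) if b == 0 :> nat then - g else f
  | _ => 0
  end.

Lemma koszul_d_homog i a b :
  bihomog (koszul_deg a - koszul_deg b) (koszul_d i a b).
Proof.
case: i a b => [|[|[|i]]] a b //=.
- rewrite mxE subr0; by case: ifP.
- rewrite mxE; case: ifP => _; last by rewrite addrK.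
  move=> m; rewrite (perm_mem (msuppN g)) => /g_homog ->.
  by rewrite addrAC subrr add0r.
- by case: a.
- by case: a.
Qed.

Lemma koszul_dd i : koszul_d i.+1 *m koszul_d i = 0.
Proof.
case: i => [|i] /=; last by rewrite mul0mx.
apply/matrixP => a b; rewrite !mxE big_ord_recl big_ord1 !mxE /=.
by rewrite mulNr mulrC addNr.
Qed.

Definition koszul : gcomplex := GComplex koszul_d_homog koszul_dd.

End Koszul.

Definition virtual_complete_intersection (X : {fset P1 k * P1 k}) : Prop :=
  exists (f g : cox k) (df dg : int * int)
         (hf : bihomog df f) (hg : bihomog dg g),
    virtual_resolution (koszul hf hg) (ideal_of X).

Section Configurations.
Local Open Scope fset_scope.

Definition proj_fst (X : {fset P1 k * P1 k}) : {fset P1 k} :=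
  [fset P.1 | P in X].
Definition proj_snd (X : {fset P1 k * P1 k}) : {fset P1 k} :=
  [fset P.2 | P in X].

(* Indices start at 0, so that the condition i <= lambda_j becomes i < lam j. *)
Definition ferrers (X : {fset P1 k * P1 k}) : Prop :=
  exists (h v : nat) (a : h.-tuple (P1 k)) (b : v.-tuple (P1 k))
         (lam : 'I_v -> nat),
    [/\ uniq a /\ a =i proj_fst X,
        uniq b /\ b =i proj_snd X,
        forall j j' : 'I_v, (j <= j')%N -> (lam j' <= lam j)%N,
        forall j, (1 <= lam j)%N
      & forall i j, (tnth a i, tnth b j) \in X <-> (i < lam j)%N].

Definition rectangle (X : {fset P1 k * P1 k}) : Prop :=
  X = proj_fst X `*` proj_snd X.

End Configurations.

End Cox.

(* Main.v *)
Require Import Defs.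
From HB Require Import structures.
From mathcomp Require Import all_boot all_order all_algebra.
From mathcomp Require Import finmap mpoly ring zify.

Set Implicit Arguments.
Unset Strict Implicit.
Unset Printing Implicit Defensive.

(**
Identify a point of P^1 x P^1 with a pair (L, M), and let a, b be the bidegree
of f, and c, d that of g.

If X is the grid A x B, then I_X is generated by the product of the equations of
the first coordinates and the product of the equations of the second ones; these
are coprime, so their Koszul complex is even exact.

Conversely, an isomorphism of sheaves preserves annihilators, so the forms f, g of
a VCI generate I_X on each standard chart, hence in all large bidegrees. The Koszul
complex then bounds the codimension of (f, g) from below by the intersection number
of f and g, that is a d + b c <= |X|. A Ferrers diagram contains a full line L of its
grid in one direction and a full line M in the other one. A form which does not
vanish identically on L has degree at least |B| along L, where |B| is the number of
points of X on L; similarly for M and |A|. Now f and g do not both vanish on L, nor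
do they both vanish on M, and neither of them vanishes on both L and M, since it
would be singular at the point where they meet, which is in X. In all the remaining
cases |A| |B| <= a d or |A| |B| <= b c. Thus |A| |B| <= |X|, and X is the whole grid.
*)

Import GRing.Theory.

(** * Nonvanishing of polynomials over an algebraically closed field *)

Section Nonvanishing.
Local Open Scope ring_scope.

Definition mnm_restr n (m : 'X_{1..n.+1}) : 'X_{1..n} :=
  [multinom m (widen_ord (leqnSn n) i) | i < n].

Lemma mnm_restr_inj n (m m' : 'X_{1..n.+1}) :
  mnm_restr m = mnm_restr m' -> m ord_max = m' ord_max -> m = m'.
Proof.
move=> /mnmP e emax; apply/mnmP => i.
case: (unliftP ord_max i) => [j ->|-> //].
have -> : lift ord_max j = widen_ord (leqnSn n) j.
  by apply/val_inj; rewrite /= /bump leqNgt ltn_ord.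
by have := e j; rewrite !mnmE.
Qed.

Lemma muniX (R : comNzRingType) n (m : 'X_{1..n.+1}) :
  muni ('X_[m] : {mpoly R[n.+1]}) = 'X_[mnm_restr m] *: 'X^(m ord_max).
Proof. by rewrite muniE msuppX big_seq1 mcoeffX eqxx scale1r. Qed.

Lemma mcoeff_muni (R : comNzRingType) n (p : {mpoly R[n.+1]}) m :
  ((muni p)`_(m ord_max))@_(mnm_restr m) = p@_m.
Proof.
elim/mpolyind: p => [|c m' p _ _ IHp]; first by rewrite muni0 coef0 !mcoeff0.
rewrite muniD coefD [LHS]mcoeffD [RHS]mcoeffD.
congr (_ + _); last exact: IHp.
rewrite muniZ muniX coefZ mcoeffCM coefZ coefXn [RHS]mcoeffZ [in RHS]mcoeffX.
congr (_ * _).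
have [e|ne] := eqVneq (m ord_max) (m' ord_max); last first.
  by rewrite mulr0 mcoeff0; case: eqP => // e; rewrite e eqxx in ne.
rewrite mulr1 mcoeffX; congr ((_ : bool)%:R); apply/eqP/eqP => [|-> //].
by move/mnm_restr_inj; apply.
Qed.

Lemma meval_muni (R : comNzRingType) n (v : 'I_n -> R) x (p : {mpoly R[n.+1]}) :
  p.@[fun i => if unlift ord_max i is Some j then v j else x]
    = (map_poly (meval v) (muni p)).[x].
Proof.
elim/mpolyind: p => [|c m p _ _ IHp].
  by rewrite meval0 muni0 map_poly0 horner0.
rewrite mevalD muniD rmorphD hornerD /=; congr (_ + _); last exact: IHp.
rewrite mevalZ muniZ muniX -mul_polyC rmorphM /= map_polyC /= mevalC hornerCM.
congr (_ * _); rewrite mevalX.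
rewrite -mul_polyC rmorphM /= map_polyC /= hornerCM mevalX map_polyXn hornerXn.
rewrite big_ord_recr /= unlift_none; congr (_ * _).
apply: eq_bigr => i _; rewrite mnmE; congr (_ ^+ _).
have -> : widen_ord (leqnSn n) i = lift ord_max i.
  by apply/val_inj; rewrite /= /bump leqNgt ltn_ord.
by rewrite liftK.
Qed.

(** Induction on [n]: by [muni], [p] is a univariate polynomial in its last variable. Some
    coefficient of it is nonzero at a point [v], and the polynomial specialized at [v] has a nonroot
    because an algebraically closed field is infinite. *)
Lemma mpoly_nonroot (F : closedFieldType) n (p : {mpoly F[n]}) :
  p != 0 -> exists v, p.@[v] != 0.
Proof.
elim: n p => [|n IHn] p p0.
  exists (fun=> 0); apply: contraNneq p0 => e.
  suff -> : p = p.@[fun=> 0]%:MP by rewrite e mpolyC0.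
  elim/mpolyind: p {e} => [|c m p _ _ IHp]; first by rewrite meval0 mpolyC0.
  have -> : m = 0%MM by apply/mnmP => -[].
  rewrite mevalD mevalZ mpolyX0 meval1 mulr1 mpolyCD -IHp.
  by rewrite -mul_mpolyC mulr1.
have [m pm] : exists m, p@_m != 0.
  by exists (mlead p); rewrite mleadc_eq0.
have := pm; rewrite -mcoeff_muni => qm.
have /IHn [v qv] : (muni p)`_(m ord_max) != 0.
  by apply: contraNneq qm => ->; rewrite mcoeff0.
have /closed_nonrootP [x rx] : map_poly (meval v) (muni p) != 0.
  apply: contraNneq qv => r0.
  move: (congr1 (fun r : {poly F} => r`_(m ord_max)) r0).
  by rewrite coef_map coef0 => ->.
by exists (fun i => if unlift ord_max i is Some j then v j else x); rewrite meval_muni.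
Qed.

End Nonvanishing.

(** * Restriction to lines and points *)

Section Points.
Local Open Scope ring_scope.
Variable k : fieldType.
Implicit Types (L M : P1 k) (p q : cox k) (s : bool).

Lemma ord2P (i : 'I_2) : i = 0 \/ i = 1.
Proof. by case: i => -[|[|//]] lti; [left | right]; apply: val_inj. Qed.

Definition rep L : 'rV[k]_2 := vpick (val L).

Lemma rep_neq0 L : rep L != 0.
Proof. by rewrite vpick0 -dimv_eq0 (eqP (valP L)). Qed.

(** The index of a coordinate that does not vanish on L; it selects a standard chart of P^1
    containing L. *)
Definition piv L : 'I_2 := if rep L 0 0 == 0 then 1 else 0.

Lemma rep_piv L : rep L 0 (piv L) != 0.
Proof.
rewrite /piv; case: ifP => [/eqP r0|-> //]; apply: contra (rep_neq0 L) => /eqP r1.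
by apply/eqP/rowP => i; rewrite mxE; case: (ord2P i) => ->.
Qed.

Definition ncoord L (i : 'I_2) : k := rep L 0 i / rep L 0 (piv L).

Lemma ncoord_piv L : ncoord L (piv L) = 1.
Proof. by rewrite /ncoord divff ?rep_piv. Qed.

Lemma P1_line L (u : 'rV_2) :
  u \in val L -> u = u 0 (piv L) *: \row_i ncoord L i.
Proof.
have -> : val L = <[rep L]>%VS.
  apply/eqP; rewrite eq_sym eqEdim -memvE memv_pick /=.
  by rewrite dim_vline rep_neq0 (eqP (valP L)).
case/vlineP => c ->; apply/rowP => i; rewrite !mxE /ncoord.
by rewrite -mulrA [rep L 0 (piv L) * _]mulrC divfK // rep_piv.
Qed.

Lemma ncoordZ_mem L c : c *: (\row_i ncoord L i) \in val L.
Proof.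
rewrite memvZ //; have -> : \row_i ncoord L i = (rep L 0 (piv L))^-1 *: rep L.
  by apply/rowP => i; rewrite !mxE mulrC.
by rewrite memvZ // memv_pick.
Qed.

Lemma ncoord_row_neq0 L c : c != 0 -> c *: (\row_i ncoord L i) != 0.
Proof.
move=> c0; apply: contra c0 => /eqP/rowP/(_ (piv L)).
by rewrite !mxE ncoord_piv mulr1 => ->.
Qed.

(** The hypothesis is the vanishing of a 2 x 2 determinant, so the two coordinate vectors are
    proportional. *)
Lemma P1_cross L M : ncoord L 1 * ncoord M 0 = ncoord L 0 * ncoord M 1 -> L = M.
Proof.
move=> e; have ev i j : ncoord L i * ncoord M j = ncoord L j * ncoord M i.
  by case: (ord2P i) => ->; case: (ord2P j) => ->.
apply/val_inj/eqP; rewrite eqEdim (eqP (valP L)) (eqP (valP M)) leqnn andbT.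
apply/subvP => u /P1_line ->; rewrite memvZ //.
have -> : \row_i ncoord L i = ncoord L (piv M) *: \row_i ncoord M i.
  by apply/rowP => i; rewrite !mxE ev ncoord_piv mulr1.
exact: ncoordZ_mem.
Qed.

(* The factor of P^1 x P^1 is encoded by a boolean: [false] for the first one,
   with variables x_0, x_1, and [true] for the second one. *)
Definition side s (i : 'I_2) : 'I_(2 + 2) :=
  if s then rshift 2 i else lshift 2 i.

Lemma sideP (n : 'I_(2 + 2)) : exists s i, n = side s i.
Proof.
by case: (split_ordP n) => i ->; [exists false | exists true]; exists i.
Qed.

Lemma side_eq s s' i i' : (side s i == side s' i') = (s == s') && (i == i').
Proof.
by rewrite /side; case: s; case: s';
  rewrite ?eq_lshift ?eq_rshift ?eq_lrshift ?eq_rlshift.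
Qed.

(* Restriction to the line L of one factor, as an endomorphism of the Cox ring:
   the variables of that factor are replaced by the normalized coordinates of L
   times the variable in which L has coordinate 1.  The kernel is the prime
   ideal generated by [lineform s L]. *)
Definition spec_tuple s L : (2 + 2).-tuple (cox k) :=
  [tuple match split n with
         | inl i => if s then 'X_n else ncoord L i *: 'X_(side s (piv L))
         | inr i => if s then ncoord L i *: 'X_(side s (piv L)) else 'X_n
         end | n < 2 + 2].

Definition spec s L p : cox k := locked (comp_mpoly (spec_tuple s L)) p.

Lemma specE s L p : spec s L p = p \mPo spec_tuple s L.
Proof. by rewrite /spec -lock. Qed.

Fact spec_zmod_morphism s L : zmod_morphism (spec s L).
Proof. by move=> p q; rewrite !specE rmorphB. Qed.

Fact spec_monoid_morphism s L : monoid_morphism (spec s L).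
Proof. by split=> [|p q]; rewrite !specE ?rmorph1 ?rmorphM. Qed.

HB.instance Definition _ s L :=
  GRing.isZmodMorphism.Build (cox k) (cox k) (spec s L) (spec_zmod_morphism s L).
HB.instance Definition _ s L :=
  GRing.isMonoidMorphism.Build (cox k) (cox k) (spec s L) (spec_monoid_morphism s L).

Lemma specZ s L c p : spec s L (c *: p) = c *: spec s L p.
Proof. by rewrite !specE comp_mpolyZ. Qed.

Lemma spec_X s L i : spec s L 'X_(side s i) = ncoord L i *: 'X_(side s (piv L)).
Proof.
rewrite specE comp_mpolyXU -tnth_nth tnth_mktuple.
by rewrite /side; case: s; rewrite ?(unsplitK (inl i)) ?(unsplitK (inr i)).
Qed.

Lemma spec_Xn s L i : spec s L 'X_(side (~~ s) i) = 'X_(side (~~ s) i).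
Proof.
rewrite specE comp_mpolyXU -tnth_nth tnth_mktuple.
by rewrite /side; case: s => /=; rewrite ?(unsplitK (inl i)) ?(unsplitK (inr i)).
Qed.

Lemma spec_Xs s L i : spec (~~ s) L 'X_(side s i) = 'X_(side s i).
Proof. by have := spec_Xn (~~ s) L i; rewrite negbK. Qed.

Lemma spec_piv s L : spec s L 'X_(side s (piv L)) = 'X_(side s (piv L)).
Proof. by rewrite spec_X ncoord_piv scale1r. Qed.

Definition lineform s L : cox k :=
  ncoord L 1 *: 'X_(side s 0) - ncoord L 0 *: 'X_(side s 1).

Lemma spec_lineform s L M : spec s M (lineform s L) =
  (ncoord L 1 * ncoord M 0 - ncoord L 0 * ncoord M 1) *: 'X_(side s (piv M)).
Proof. by rewrite /lineform rmorphB /= !specZ !spec_X !scalerA scalerBl. Qed.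

Lemma spec_lineform0 s L : spec s L (lineform s L) = 0.
Proof. by rewrite spec_lineform mulrC subrr scale0r. Qed.

Lemma mpolyX_neq0 n (m : 'X_{1..n}) : ('X_[m] : {mpoly k[n]}) != 0.
Proof. by rewrite -msupp_eq0 msuppX. Qed.

Lemma spec_lineform_neq0 s L M : L != M -> spec s M (lineform s L) != 0.
Proof.
move=> LM; rewrite spec_lineform scaler_eq0 negb_or mpolyX_neq0 andbT subr_eq0.
by apply: contra LM => /eqP/P1_cross ->.
Qed.

Lemma spec_lineformn s L M : spec (~~ s) M (lineform s L) = lineform s L.
Proof. by rewrite /lineform rmorphB /= !specZ !spec_Xs. Qed.

(** The pivot coordinate is 1, so up to sign the equation of L is the non-pivot variable minus its
    image under [spec]. *)
Lemma lineform_piv L s : exists c : k, c *: lineform s L =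
  'X_(side s (if piv L == 0 then 1 else 0)) -
    ncoord L (if piv L == 0 then 1 else 0) *: 'X_(side s (piv L)).
Proof.
have := ncoord_piv L; case: (ord2P (piv L)) => -> e; rewrite /lineform e /=.
  by exists (-1); rewrite scaleN1r opprB scale1r.
by exists 1; rewrite !scale1r.
Qed.

(** Write x', y' for the restrictions of x, y. Since xy - x'y' = x(y - y') + (x - x')y', the
    property passes to products, and it suffices to check it on variables. *)
Lemma spec_ker s L p : exists q, p - spec s L p = q * lineform s L.
Proof.
elim/mpolyind: p => [|c m p _ _ [q IHp]].
  by exists 0; rewrite rmorph0 subrr mul0r.
suff [q' e] : exists q', 'X_[m] - spec s L 'X_[m] = q' * lineform s L.
  exists (c *: q' + q); rewrite rmorphD /= specZ opprD addrACA -scalerBr e IHp.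
  by rewrite mulrDl scalerAl.
rewrite mpolyXE_id; apply: (big_ind (fun r => exists q, r - spec s L r = q * lineform s L)).
- by exists 0; rewrite rmorph1 subrr mul0r.
- move=> x y [qx ex] [qy ey]; exists (x * qy + qx * spec s L y).
  by rewrite rmorphM /= mulrDl -mulrA -ey mulrAC -ex; ring.
move=> n _; elim: (m n) => [|d [qy ey]].
  by exists 0; rewrite expr0 rmorph1 subrr mul0r.
have [qx ex] : exists q, 'X_n - spec s L 'X_n = q * lineform s L.
  have [s' [i ->]] := sideP n; have [->|] := eqVneq s' (~~ s).
    by exists 0; rewrite spec_Xn subrr mul0r.
  have -> b b' : (b != ~~ b') = (b == b') by case: b b' => -[].
  move/eqP => ->; rewrite spec_X; have [->|ne] := eqVneq i (piv L).
    by exists 0; rewrite ncoord_piv scale1r subrr mul0r.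
  have [a e] := lineform_piv L s; exists a%:MP; rewrite mul_mpolyC e.
  have -> // : (if piv L == 0 then 1 else 0) = i.
  by move: ne; case: (ord2P i) => ->; case: (ord2P (piv L)) => ->.
exists ('X_n * qy + qx * spec s L ('X_n ^+ d)); rewrite exprS.
by rewrite rmorphM /= mulrDl -mulrA -ey mulrAC -ex; ring.
Qed.

Lemma spec_eq0 s L p : spec s L p = 0 -> exists q, p = q * lineform s L.
Proof. by move=> e; have [q] := spec_ker s L p; rewrite e subr0; exists q. Qed.

End Points.

(** * The ideal of a grid *)

Section Grid.
Local Open Scope ring_scope.
Variable k : fieldType.
Implicit Types (L M : P1 k) (p q : cox k) (s : bool) (A B : seq (P1 k)).

Definition lprod s A : cox k := \prod_(L <- A) lineform s L.

Lemma lprod_cons s L A : lprod s (L :: A) = lineform s L * lprod s A.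
Proof. exact: big_cons. Qed.

Lemma spec_lprodn s A M : spec (~~ s) M (lprod s A) = lprod s A.
Proof. by rewrite rmorph_prod; apply: eq_bigr => L _; apply: spec_lineformn. Qed.

Lemma spec_lprod0 s A M : M \in A -> spec s M (lprod s A) = 0.
Proof.
elim: A => // L A IHA; rewrite in_cons lprod_cons rmorphM /=.
by case/predU1P => [<-|/IHA ->]; rewrite ?spec_lineform0 ?mul0r ?mulr0.
Qed.

Lemma spec_lprod_neq0 s A M : M \notin A -> spec s M (lprod s A) != 0.
Proof.
elim: A => [|L A IHA]; first by rewrite /lprod big_nil rmorph1 oner_neq0.
rewrite in_cons negb_or lprod_cons rmorphM => /andP[ML /IHA MA].
by apply: mulf_neq0 MA; apply: spec_lineform_neq0; rewrite eq_sym.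
Qed.

Lemma lineform_neq0 s L : lineform s L != 0.
Proof.
apply: contraTneq isT => e; have e0 := ncoord_piv L.
have /(congr1 (fun p => p@_U_(side s (if piv L == 0 then 1 else 0)))) := e.
rewrite /lineform mcoeffB !mcoeffZ !mcoeffXU mcoeff0.
rewrite !side_eq !eqxx /=; move: e0; case: (ord2P (piv L)) => -> -> /=.
  by rewrite mulr0 sub0r mulr1 => /eqP; rewrite oppr_eq0 oner_eq0.
by rewrite mulr1 mulr0 subr0 => /eqP; rewrite oner_eq0.
Qed.

Lemma lprod_neq0 s A : lprod s A != 0.
Proof. by rewrite prodf_seq_neq0; apply/allP => L _; apply: lineform_neq0. Qed.

(** The equations are divided out one at a time: the equation of L does not vanish on the other
    lines of [A], so the quotient still vanishes there. *)
Lemma lprod_dvd s A q : uniq A -> (forall L, L \in A -> spec s L q = 0) ->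
  exists q', q = q' * lprod s A.
Proof.
elim: A q => [|L A IHA] q /=.
  by exists q; rewrite /lprod big_nil mulr1.
case/andP=> LA uA qA; have [|q1 e] := @spec_eq0 _ s L q.
  by apply: qA; rewrite mem_head.
have [//|M MA|q' e'] := IHA q1; last first.
  by exists q'; rewrite lprod_cons mulrCA -e' e mulrC.
apply/eqP; have/eqP : spec s M q = 0 by apply: qA; rewrite in_cons MA orbT.
rewrite e rmorphM mulf_eq0 => /orP[//|]; rewrite (negPf (spec_lineform_neq0 _ _)) //.
by apply: contraNneq LA => ->.
Qed.

(* Restriction to the cone over the point P. *)
Definition phi (P : P1 k * P1 k) p : cox k := spec false P.1 (spec true P.2 p).
HB.instance Definition _ P :=
  GRing.RMorphism.copy (phi P) (spec false P.1 \o spec true P.2)%FUN.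

Lemma phiE P p : phi P p = spec false P.1 (spec true P.2 p).
Proof. by []. Qed.

Lemma phiZ P c p : phi P (c *: p) = c *: phi P p.
Proof. by rewrite !phiE !specZ. Qed.

Lemma phi_lprodx P A : phi P (lprod false A) = spec false P.1 (lprod false A).
Proof. by rewrite phiE (spec_lprodn false). Qed.

Lemma phi_lprody P A : phi P (lprod true A) = spec true P.2 (lprod true A).
Proof.
rewrite /lprod !rmorph_prod; apply: eq_bigr => L _ /=.
by rewrite phiE !spec_lineform specZ (spec_Xs true).
Qed.

(** Induction on [B]: the restriction of [p] to the line M is divisible by [lprod false A], and [p]
    minus this restriction is a multiple of the equation of M whose cofactor vanishes on the smaller
    grid. *)
Lemma grid_ideal A B p : uniq A -> uniq B ->
  (forall L M, L \in A -> M \in B -> phi (L, M) p = 0) ->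
  exists u v, p = u * lprod false A + v * lprod true B.
Proof.
move=> uA; elim: B p => [|M B IHB] p /=.
  by exists 0, p; rewrite mul0r add0r /lprod big_nil mulr1.
case/andP=> MB uB pAB; have [|u eu] := @lprod_dvd false A (spec true M p) uA.
  by move=> L LA; apply: (pAB L M LA); rewrite mem_head.
have [v ev] := spec_ker true M p.
have [//|L N LA NB|u' [v' e']] := IHB v; last first.
  exists (u + u' * lineform true M), v'; rewrite lprod_cons.
  by rewrite -[p](subrK (spec true M p)) ev eu e'; ring.
have /eqP : phi (L, N) p = 0 by apply: pAB; rewrite // in_cons NB orbT.
rewrite -[p](subrK (spec true M p)) ev eu rmorphD !rmorphM /=.
rewrite phi_lprodx spec_lprod0 // mulr0 addr0 mulf_eq0.
case/orP=> [/eqP //|]; rewrite phiE spec_lineform specZ (spec_Xs true) scaler_eq0.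
rewrite (negPf (mpolyX_neq0 _ _)) orbF subr_eq0 => /eqP/P1_cross e.
by rewrite e NB in MB.
Qed.

Lemma lprod_coprime A B p q : uniq B ->
  p * lprod false A = q * lprod true B -> exists p', p = p' * lprod true B.
Proof.
move=> uB e; apply: lprod_dvd => // M MB; apply/eqP.
have /eqP := congr1 (spec true M) e; rewrite !rmorphM /= (spec_lprodn false).
by rewrite spec_lprod0 // mulr0 mulf_eq0 (negPf (lprod_neq0 _ _)) orbF.
Qed.

Lemma meval_spec s L p w :
  (spec s L p).@[w] = p.@[fun n => (spec s L 'X_n).@[w]].
Proof.
rewrite specE comp_mpoly_meval; apply: meval_eq => n.
by rewrite specE comp_mpolyXU -tnth_nth.
Qed.

Lemma meval_phi P p w : (phi P p).@[w] =
  p.@[row_mx (w (side false (piv P.1)) *: \row_i ncoord P.1 i)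
             (w (side true (piv P.2)) *: \row_i ncoord P.2 i) 0].
Proof.
rewrite phiE !meval_spec; apply: meval_eq => n.
have [[] [i ->]] := sideP n.
  rewrite spec_X mevalZ mevalXU (spec_Xn false) mevalXU.
  by rewrite /side row_mxEr !mxE mulrC.
by rewrite (spec_Xn true) mevalXU spec_X mevalZ mevalXU /side row_mxEl !mxE mulrC.
Qed.

(** The variable of the factor [s] that survives [phi P]; the two of them are coordinates on the
    cone over P. *)
Definition pvar (P : P1 k * P1 k) s : cox k :=
  'X_(side s (piv (if s then P.2 else P.1))).

Lemma pvar_neq0 P s : pvar P s != 0.
Proof. exact: mpolyX_neq0. Qed.

Lemma phi_pvar P s : phi P (pvar P s) = pvar P s.
Proof.
rewrite phiE /pvar; case: s; first by rewrite spec_piv (spec_Xn false).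
by rewrite (spec_Xn true) spec_piv.
Qed.

Lemma phi_vanish P p : phi P p = 0 -> vanish_at p P.
Proof.
move=> e u v uP vP _ _; rewrite (P1_line uP) (P1_line vP).
pose w (n : 'I_(2 + 2)) :=
  if split n is inl _ then u 0 (piv P.1) else v 0 (piv P.2).
have := meval_phi P p w; rewrite e meval0 /w /side.
by rewrite (unsplitK (inl _)) (unsplitK (inr _)) => <-.
Qed.

End Grid.

Section VanishingLocus.
Local Open Scope ring_scope.
Variable k : closedFieldType.

(** If [phi P p] were nonzero, so would be its product with both surviving variables. A nonroot of
    this product gives nonzero representatives of P at which [p] does not vanish. *)
Lemma vanish_phi (P : P1 k * P1 k) p : vanish_at p P <-> phi P p = 0.
Proof.
split=> [e|]; last exact: phi_vanish.
apply/eqP; suff : pvar P false * pvar P true * phi P p == 0.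
  by rewrite mulf_eq0 mulf_eq0 !(negPf (pvar_neq0 _ _)).
apply: contraT => /mpoly_nonroot [w]; rewrite !mevalM !mevalXU.
rewrite !mulf_eq0 !negb_or -andbA => /and3P[w1 w2].
by rewrite meval_phi e ?eqxx //= ?ncoordZ_mem ?ncoord_row_neq0.
Qed.

End VanishingLocus.

(** * Bihomogeneous forms *)

Section Bihomogeneous.
Local Open Scope ring_scope.
Variable k : fieldType.
Implicit Types (p q : cox k) (d e : int * int) (s : bool).

Lemma bidegD (m1 m2 : 'X_{1..(2 + 2)}) : bideg (m1 + m2)%MM = bideg m1 + bideg m2.
Proof.
rewrite /bideg; congr (_, _); rewrite -PoszD -big_split; congr Posz;
by apply: eq_bigr => i _; rewrite mnmDE.
Qed.

Lemma bihomog0 d : bihomog d (0 : cox k).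
Proof. by move=> m; rewrite msupp0. Qed.

Lemma bihomogD d p q : bihomog d p -> bihomog d q -> bihomog d (p + q).
Proof. by move=> hp hq m /msuppD_le; rewrite mem_cat => /orP[/hp|/hq]. Qed.

Lemma bihomogZ d c p : bihomog d p -> bihomog d (c *: p).
Proof. by move=> hp m /msuppZ_le /hp. Qed.

Lemma bihomogB d p q : bihomog d p -> bihomog d q -> bihomog d (p - q).
Proof. by move=> hp hq; rewrite -scaleN1r; apply/bihomogD/bihomogZ. Qed.

Lemma bihomogM d e p q : bihomog d p -> bihomog e q -> bihomog (d + e) (p * q).
Proof.
move=> hp hq m /msuppM_le /allpairsP[[m1 m2] /= [/hp <- /hq <- ->]].
exact: bidegD.
Qed.

Lemma bihomogX m : bihomog (bideg m) ('X_[m] : cox k).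
Proof. by move=> m'; rewrite msuppX inE => /eqP ->. Qed.

Lemma bihomog1 : bihomog 0 (1 : cox k).
Proof.
move=> m; rewrite msupp1 inE => /eqP ->; rewrite /bideg.
by rewrite !big1 // => i _; rewrite mnm0E.
Qed.

Lemma bihomogXn d p n : bihomog d p -> bihomog (d *+ n) (p ^+ n).
Proof.
move=> hp; elim: n => [|n IHn]; first by rewrite expr0; apply: bihomog1.
by rewrite exprS mulrS; apply: bihomogM.
Qed.

Definition vdeg s : int * int := if s then (0, 1) else (1, 0).

Lemma vdegE a b : (a%:Z, b%:Z) = vdeg false *+ a + vdeg true *+ b.
Proof.
by rewrite /vdeg; congr (_, _); rewrite !raddfMn /= !mul0rn ?addr0 ?add0r !natz.
Qed.

Lemma bideg1 s i : bideg U_(side s i) = vdeg s.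
Proof.
rewrite /bideg /vdeg /side !big_ord_recl !big_ord0 !mnmE.
by case: s; case: (ord2P i) => ->.
Qed.

Lemma bihomog_var s i : bihomog (vdeg s) ('X_(side s i) : cox k).
Proof. by rewrite -(bideg1 s i); apply: bihomogX. Qed.

Lemma bihomog_lineform s (L : P1 k) : bihomog (vdeg s) (lineform s L).
Proof. by apply: bihomogB; apply/bihomogZ/bihomog_var. Qed.

Lemma bihomog_lprod s (A : seq (P1 k)) : bihomog (vdeg s *+ size A) (lprod s A).
Proof.
elim: A => [|L A IHA]; first by rewrite /lprod big_nil; apply: bihomog1.
by rewrite lprod_cons mulrS; apply/bihomogM/IHA/bihomog_lineform.
Qed.

Lemma bihomog_nat d p : p != 0 -> bihomog d p -> exists a b : nat, d = (a%:Z, b%:Z).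
Proof. by move=> p0 /(_ _ (mlead_supp p0)) <-; do 2!eexists. Qed.

End Bihomogeneous.

(** * Sheaves and Koszul complexes *)

Section Sheaves.
Local Open Scope ring_scope.
Variable k : fieldType.

(** In [gmodule] the relations are a bare predicate. These closure properties make [frac_eq] an
    equivalence relation. *)
Definition gm_submod (M : gmodule k) : Prop :=
  [/\ gm_rel (g := M) 0,
      forall x y, gm_rel (g := M) x -> gm_rel (g := M) y -> gm_rel (g := M) (x + y)
    & forall c x, gm_rel (g := M) x -> gm_rel (g := M) (c *: x)].

Lemma frac_eq_refl (M : gmodule k) h (s : loc_frac M) : gm_submod M -> frac_eq h s s.
Proof. by case=> M0 _ _; exists 0%N; rewrite subrr scaler0. Qed.

Lemma frac_eq_sym (M : gmodule k) h (s s' : loc_frac M) :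
  gm_submod M -> frac_eq h s s' -> frac_eq h s' s.
Proof.
by case=> _ _ MZ [r e]; exists r; rewrite -opprB scalerN -scaleN1r; apply: MZ.
Qed.

Lemma scale_telescope (R : comNzRingType) (V : lmodType R) (h : R) (x1 x2 x3 : V)
    (r r' a b c : nat) :
  h ^+ (r + r' + b) *: (h ^+ c *: x1 - h ^+ a *: x3) =
  h ^+ (r' + c) *: (h ^+ r *: (h ^+ b *: x1 - h ^+ a *: x2)) +
  h ^+ (r + a) *: (h ^+ r' *: (h ^+ c *: x2 - h ^+ b *: x3)).
Proof.
rewrite !scalerBr !scalerA -!exprD.
have -> : (r + a + r' + c = r' + c + r + a)%N by lia.
rewrite addrA subrK; congr (h ^+ _ *: _ - h ^+ _ *: _); lia.
Qed.

Lemma frac_eq_trans (M : gmodule k) h (s2 s1 s3 : loc_frac M) :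
  gm_submod M -> frac_eq h s1 s2 -> frac_eq h s2 s3 -> frac_eq h s1 s3.
Proof.
case=> _ MD MZ [r e] [r' e'].
exists (r + r' + s2.2)%N; set x := (X in gm_rel X).
suff -> : x = h ^+ (r' + s3.2) *: (h ^+ r *: (h ^+ s2.2 *: s1.1 - h ^+ s1.2 *: s2.1))
  + h ^+ (r + s1.2) *: (h ^+ r' *: (h ^+ s3.2 *: s2.1 - h ^+ s2.2 *: s3.1)).
  by apply: MD; apply: MZ.
exact: scale_telescope.
Qed.

Lemma sheaf_iso_same n deg (R1 R2 : 'rV[cox k]_n -> Prop) :
  gm_submod (GModule deg R2) -> (forall v, R1 v <-> R2 v) ->
  sheaf_iso (GModule deg R1) (GModule deg R2).
Proof.
move=> R2s R12.
have R1s : gm_submod (GModule deg R1).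
  case: R2s => R0 RD RZ; split=> [|x y|c x] /=; first exact/R12.
  - by move/R12 => Rx /R12 Ry; apply/R12; exact: (RD _ _ Rx Ry).
  - by move/R12 => Rx; apply/R12; exact: (RZ _ _ Rx).
exists (fun=> id), (fun=> id); split.
- split=> //.
  + by move=> d h s s' _ _ _ [r e]; exists r; apply/R12.
  + by move=> *; apply: frac_eq_refl.
  + by move=> *; apply: frac_eq_refl.
  + by move=> *; apply: frac_eq_refl.
- split=> //.
  + by move=> d h s s' _ _ _ [r e]; exists r; apply/R12.
  + by move=> *; apply: frac_eq_refl.
  + by move=> *; apply: frac_eq_refl.
  + by move=> *; apply: frac_eq_refl.
- by move=> *; apply: frac_eq_refl.
- by move=> *; apply: frac_eq_refl.
Qed.

End Sheaves.

Section Koszul.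
Local Open Scope ring_scope.
Variable k : fieldType.
Variables (f g : cox k) (df dg : int * int).
Hypotheses (hf : bihomog df f) (hg : bihomog dg g).

Definition ideal2 (p : cox k) : Prop := exists u v, p = u * f + v * g.

Lemma coker0_koszul v : gm_rel (g := coker0 (koszul hf hg)) v <-> ideal2 (v 0 0).
Proof.
split=> [[w ->]|[a [b e]]].
  by exists (w 0 ord0), (w 0 (lift ord0 ord0)); rewrite !mxE big_ord_recl big_ord1 !mxE.
exists (\row_i if i == 0 then a else b); apply/rowP => i.
rewrite !mxE big_ord_recl big_ord1 !mxE /= -e.
by congr (v _ _); rewrite ?(ord1 i).
Qed.

Lemma koszul_submod : gm_submod (coker0 (koszul hf hg)).
Proof.
split=> [|x y /= [w ->] [w' ->]|c x /= [w ->]].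
- by exists 0; rewrite mul0mx.
- by exists (w + w'); rewrite mulmxDl.
- by exists (c *: w); rewrite -scalemxAl.
Qed.

(** The second hypothesis says that all relations between [f] and [g] are Koszul relations, so H_1 =
    0; H_2 = 0 because the Cox ring is a domain, and the modules further on are zero. *)
Lemma koszul_exact i b : f != 0 \/ g != 0 ->
  (forall p q, p * f = q * g -> exists r, p = r * g /\ q = r * f) ->
  annihilates_homology (koszul hf hg) i b.
Proof.
move=> fg0 reg; case: i => [|[|i]] z /=.
- move/(congr1 (fun M : 'M_(1, 1) => M 0 0)).
  rewrite !mxE big_ord_recl big_ord1 !mxE /= => /eqP; rewrite addr_eq0 -mulNr.
  move/eqP/reg => [r [e0 e1]]; exists (- b *: r%:M); apply/rowP => j.
  rewrite !mxE big_ord1 !mxE /= mulr1n.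
  case: (ord2P j) => -> /=.
    by rewrite e0; ring.
  rewrite -[z _ _]opprK; have -> : - z 0 1 = r * f.
    by rewrite -e1; congr (- z _ _); apply: val_inj.
  ring.
- move=> e; exists 0; rewrite mulmx0; apply/rowP => j; rewrite !mxE (ord1 j).
  suff -> : z 0 0 = 0 by rewrite mulr0.
  move/rowP: e => e; case: fg0 => [f0|g0].
    have := e 1; rewrite !mxE big_ord1 !mxE /= => /eqP.
    by rewrite mulf_eq0 (negPf f0) orbF => /eqP.
  have := e 0; rewrite !mxE big_ord1 !mxE /= => /eqP.
  by rewrite mulf_eq0 oppr_eq0 (negPf g0) orbF => /eqP.
- by exists 0; apply/rowP => -[].
Qed.

End Koszul.

(** * Rectangles are virtual complete intersections *)

Section Rectangle.
Local Open Scope ring_scope.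
Variable k : closedFieldType.

Lemma ideal_of_grid (X : {fset P1 k * P1 k}) p : rectangle X ->
  ideal_of X p <-> ideal2 (lprod false (proj_fst X)) (lprod true (proj_snd X)) p.
Proof.
move=> rX; split=> [pX|[u [v ->]] P].
  apply: grid_ideal; rewrite ?fset_uniq // => L M LX MX.
  by apply/vanish_phi/pX; rewrite [X in _ \in X]rX inE LX.
rewrite [X in P \in X]rX inE => /andP[P1X P2X]; apply/vanish_phi.
have e1 : spec false P.1 (lprod false (proj_fst X)) = 0 by apply: spec_lprod0.
have e2 : spec true P.2 (lprod true (proj_snd X)) = 0 by apply: spec_lprod0.
rewrite rmorphD !rmorphM /= phi_lprodx phi_lprody.
by rewrite e1 e2 !mulr0 addr0.
Qed.

Lemma rectangle_vci (X : {fset P1 k * P1 k}) :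
  rectangle X -> virtual_complete_intersection X.
Proof.
move=> rX; set f := lprod false (proj_fst X); set g := lprod true (proj_snd X).
have hf : bihomog (vdeg false *+ size (proj_fst X)) f by apply: bihomog_lprod.
have hg : bihomog (vdeg true *+ size (proj_snd X)) g by apply: bihomog_lprod.
exists f, g, _, _, hf, hg; split.
  (* The higher homology vanishes, so any positive exponent serves. *)
  move=> i; exists 1%N => // b _; apply: koszul_exact.
    by left; apply: lprod_neq0.
  move=> p q e; have [r er] := lprod_coprime (fset_uniq (proj_snd X)) e.
  exists r; split=> //; have g0 : g != 0 by apply: lprod_neq0.
  by apply: (mulIf g0); rewrite -e er mulrAC.
apply: sheaf_iso_same; first exact: koszul_submod.
move=> v; split=> [/(ideal_of_grid (v 0 0) rX) fgv|fgv].
  exact: (iffRL (coker0_koszul (hf := hf) (hg := hg) v) fgv).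
apply: (iffRL (ideal_of_grid (v 0 0) rX)).
exact: (iffLR (coker0_koszul (hf := hf) (hg := hg) v) fgv).
Qed.

End Rectangle.

(** * From the isomorphism of sheaves to ideals on charts *)

Section SheafAnnihilator.
Local Open Scope ring_scope.
Variable k : fieldType.

Lemma frac_eq0 (M : gmodule k) h (x : 'rV_(gm_rk M)) n :
  frac_eq h ((x, n) : loc_frac M) (0, n) -> exists r, gm_rel (h ^+ r *: x).
Proof.
case=> r; rewrite /= scaler0 subr0 scalerA -exprD => e.
by exists (r + n)%N.
Qed.

(* If p kills M, then p s = p psi(phi s) = psi(p phi(s)) = psi(0) = 0 on D(h). *)
Lemma sheaf_iso_annihilator (M N : gmodule k) d h p t (s : loc_frac N) :
  gm_submod M -> gm_submod N -> sheaf_iso M N ->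
  basic_open d h -> bihomog (d *+ t) p -> is_section d s ->
  (forall m : 'rV_(gm_rk M), gm_rel (p *: m)) ->
  exists r, gm_rel (h ^+ r *: (p *: s.1)).
Proof.
move=> Ms Ns [psi [ph [psiM phM _ psiK]]] hd ncoords ss pM0.
set u := ph h s; have us : is_section d u by apply: (sheaf_morph_section phM).
set w := psi h u.
have sec q : bihomog (d *+ t) q -> is_section d (frac_scale q t u).
  move=> qt i; rewrite /= mxE mulrnDr -addrA.
  by apply: bihomogM => //; apply: us.
have t0 : bihomog (d *+ t) (0 : cox k) by apply: bihomog0.
have E1 : frac_eq h (psi h (frac_scale p t u)) (psi h (frac_scale 0 t u)).
  apply: (sheaf_morph_eq psiM hd); try exact: sec.
  exists 0%N; rewrite /= scale0r scaler0 subr0 expr0 scale1r scalerA mulrC -scalerA.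
  by rewrite scalerA mulrC -scalerA; case: Ms => _ _ MZ; apply: MZ.
have E2 := sheaf_morph_scale psiM hd ncoords us.
have E3 := sheaf_morph_scale psiM hd t0 us.
have E4 : frac_eq h (frac_scale p t w) (0, (t + w.2)%N).
  have E5 : frac_eq h (frac_scale 0 t w) (0, (t + w.2)%N).
    by rewrite /frac_scale scale0r; apply: frac_eq_refl.
  have E6 := frac_eq_trans Ns E1 (frac_eq_trans Ns E3 E5).
  exact: (frac_eq_trans Ns (frac_eq_sym Ns E2) E6).
have [r Er] := frac_eq0 E4.
have [r' Er'] := psiK _ _ _ hd ss.
(* Up to powers of [h], p s is p w minus p times the difference of w = psi(phi s) and s; both terms
   are relations. *)
case: Ns => _ ND NZ; exists (r + r' + w.2)%N.
set x := (X in gm_rel X).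
suff -> : x = h ^+ (r' + s.2) *: (h ^+ r *: (p *: w.1)) +
  (- (h ^+ r * p)) *: (h ^+ r' *: (h ^+ s.2 *: w.1 - h ^+ w.2 *: s.1)).
  by apply: ND; apply: NZ.
rewrite /x !scalerBr !scalerA !mulNr !scaleNr opprK addrA -mulrA.
rewrite [X in X *: w.1 - _](_ : _ = h ^+ r * p * (h ^+ r' * h ^+ s.2)).
  by rewrite mulrA subrr add0r !exprD; congr (_ *: _); ring.
by rewrite exprD; ring.
Qed.

End SheafAnnihilator.

Section Ideal2.
Local Open Scope ring_scope.
Variable k : fieldType.
Implicit Types (p q f g : cox k).

Lemma ideal2M f g p q : ideal2 f g p -> ideal2 f g (q * p).
Proof. by case=> u [v ->]; exists (q * u), (q * v); rewrite mulrDr !mulrA. Qed.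

Lemma ideal2D f g p q : ideal2 f g p -> ideal2 f g q -> ideal2 f g (p + q).
Proof.
case=> u [v ->] [u' [v' ->]]; exists (u + u'), (v + v').
by rewrite !mulrDl addrACA.
Qed.

Lemma ideal2_sym f g p : ideal2 f g p -> ideal2 g f p.
Proof. by case=> u [v ->]; exists v, u; rewrite addrC. Qed.

Lemma ideal2_0 f g : ideal2 f g 0.
Proof. by exists 0, 0; rewrite !mul0r addr0. Qed.

Definition chart (r s : 'I_2) : cox k := 'X_(side false r) * 'X_(side true s).

(* On each of the four standard affine charts, f and g generate the ideal of X. *)
Definition cuts (X : {fset P1 k * P1 k}) f g : Prop :=
  [/\ ideal_of X f, ideal_of X g &
      forall (a b : nat) p, bihomog (a%:Z, b%:Z) p -> ideal_of X p ->
      forall r s, exists N, ideal2 f g (chart r s ^+ N * p)].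

Lemma cuts_sym X f g : cuts X f g -> cuts X g f.
Proof.
case=> hf hg H; split=> // a b p hp pX r s.
by have [N /ideal2_sym] := H a b p hp pX r s; exists N.
Qed.

Lemma chart_open r s : basic_open (vdeg false + vdeg true) (chart r s).
Proof. by split=> //; apply: bihomogM; apply: bihomog_var. Qed.

(* Fractions over a chart have denominators of bidegree (t, t), so forms of
   other bidegrees must be completed to be read in degree (0, 0). *)
Lemma balance a b p r s : bihomog (a%:Z, b%:Z) p ->
  bihomog ((vdeg false + vdeg true) *+ (a + b))
    ('X_(side false r) ^+ b * 'X_(side true s) ^+ a * p).
Proof.
rewrite vdegE => hp; have -> : (vdeg false + vdeg true) *+ (a + b) =
  vdeg false *+ b + vdeg true *+ a + (vdeg false *+ a + vdeg true *+ b).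
  by rewrite addrACA -!mulrnDr mulrnDl [(b + a)%N]addnC.
by do 2!apply: bihomogM => //; apply/bihomogXn/bihomog_var.
Qed.

End Ideal2.

Section VirtualCI.
Local Open Scope ring_scope.
Variable k : closedFieldType.
Implicit Types (p q f g : cox k) (X : {fset P1 k * P1 k}).

Lemma ideal_ofP X p : ideal_of X p <-> forall P, P \in X -> phi P p = 0.
Proof. by split=> H P PX; apply/vanish_phi/H. Qed.

Lemma ideal_of_submod X : gm_submod (quot_ring (ideal_of X)).
Proof.
split=> [|x y /ideal_ofP hx /ideal_ofP hy|c x /ideal_ofP hx]; apply/ideal_ofP => P PX.
- by rewrite mxE rmorph0.
- by rewrite mxE rmorphD /= hx // hy // addr0.
- by rewrite mxE rmorphM /= hx // mulr0.
Qed.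

Lemma sheaf_iso_sym (M N : gmodule k) : sheaf_iso M N -> sheaf_iso N M.
Proof. by case=> psi [ph [H1 H2 H3 H4]]; exists ph, psi. Qed.

Lemma phi_chart (P : P1 k * P1 k) :
  phi P (chart k (piv P.1) (piv P.2)) = chart k (piv P.1) (piv P.2).
Proof.
by rewrite rmorphM; congr (_ * _); [exact: (phi_pvar P false) | exact: (phi_pvar P true)].
Qed.

Lemma chart_neq0 (F : fieldType) r s : chart F r s != 0.
Proof. by apply: mulf_neq0; apply: mpolyX_neq0. Qed.

Section Cuts.
Variables (X : {fset P1 k * P1 k}) (f g : cox k) (df dg : int * int).
Hypotheses (hf : bihomog df f) (hg : bihomog dg g).
Hypothesis iso : sheaf_iso (quot_ring (ideal_of X)) (coker0 (koszul hf hg)).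

Let J := coker0 (koszul hf hg).

(** Such a [p] kills the cokernel, hence kills S/I_X on a chart around each point P of X. Applied to
    the section 1, this puts [p] times factors that do not vanish at P in I_X. *)
Lemma vci_vanish p d : bihomog d p -> ideal2 f g p -> ideal_of X p.
Proof.
move=> hp Jp; apply/ideal_ofP => P PX.
(* The zero form is set aside because its bidegree may be negative. *)
have [->|p0] := eqVneq p 0; first by rewrite rmorph0.
have [a [b e]] := bihomog_nat p0 hp; rewrite {}e in hp.
have hp' := balance (r := piv P.1) (s := piv P.2) hp.
have s1 : @is_section _ (quot_ring (ideal_of X)) (vdeg false + vdeg true) (1, 0%N).
  by move=> i; rewrite mxE ord1 eqxx mulr0n subr0; apply: bihomog1.
have pJ m : gm_rel (g := J) ((pvar P false ^+ b * pvar P true ^+ a * p) *: m).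
  apply: (iffRL (coker0_koszul _)); rewrite mxE mulrC.
  by do 2!apply: ideal2M.
have [n] := sheaf_iso_annihilator (koszul_submod hf hg) (ideal_of_submod X)
  (sheaf_iso_sym iso) (chart_open k (piv P.1) (piv P.2)) hp' s1 pJ.
rewrite /= => /ideal_ofP/(_ P PX) /eqP; rewrite !mxE /= mulr1.
rewrite rmorphM /= mulf_eq0 rmorphXn /= phi_chart.
rewrite expf_eq0 (negPf (chart_neq0 _ _ _)) andbF /=.
rewrite rmorphM mulf_eq0 rmorphM mulf_eq0 !rmorphXn !expf_eq0 /=.
rewrite (phi_pvar P false) (phi_pvar P true).
by rewrite !(negPf (pvar_neq0 _ _)) !andbF => /eqP.
Qed.

(** The same transfer in the other direction: a form of I_X kills S/I_X, hence the class of 1 in the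
    cokernel on each chart. *)
Lemma vci_cuts : cuts X f g.
Proof.
split.
- by apply: vci_vanish hf _; exists 1, 0; rewrite mul1r mul0r addr0.
- by apply: vci_vanish hg _; exists 0, 1; rewrite mul1r mul0r add0r.
move=> a b p hp pX r s.
have hp' := balance (r := r) (s := s) hp.
have s1 : @is_section _ J (vdeg false + vdeg true) (1, 0%N).
  by move=> i; rewrite mxE (ord1 i) eqxx mulr0n subr0; apply: bihomog1.
have pX' m : gm_rel (g := quot_ring (ideal_of X))
    (('X_(side false r) ^+ b * 'X_(side true s) ^+ a * p) *: m).
  apply/ideal_ofP => P PX; rewrite mxE !rmorphM /=.
  by rewrite (iffLR (ideal_ofP _ _) pX P PX) mulr0 mul0r.
have [n] := sheaf_iso_annihilator (ideal_of_submod X) (koszul_submod hf hg)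
  iso (chart_open k r s) hp' s1 pX'.
move=> /(iffLR (coker0_koszul _)); rewrite !mxE /= mulr1 => Jn.
(* Multiplying by x^a y^b completes the balancing factor x^b y^a to a power of the chart form. *)
exists (n + (a + b))%N; rewrite exprD /chart.
have -> : ('X_(side false r) * 'X_(side true s)) ^+ n *
   ('X_(side false r) * 'X_(side true s)) ^+ (a + b) * p =
  ('X_(side false r) ^+ a * 'X_(side true s) ^+ b) *
  (('X_(side false r) * 'X_(side true s)) ^+ n *
  ('X_(side false r) ^+ b * 'X_(side true s) ^+ a * p)).
  by rewrite [_ ^+ (a + b)]exprMn !exprD; ring.
exact: ideal2M.
Qed.

End Cuts.

End VirtualCI.

(** * Restrictions of the two generators to lines *)

Section Substitution.
Local Open Scope ring_scope.
Variable k : fieldType.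
Implicit Types (p q f g : cox k) (s : bool).

Lemma bihomog_prod (I : Type) (r : seq I) (d : I -> int * int) (F : I -> cox k) :
  (forall i, bihomog (d i) (F i)) -> bihomog (\sum_(i <- r) d i) (\prod_(i <- r) F i).
Proof.
move=> dF; elim: r => [|i r IHr]; first by rewrite !big_nil; apply: bihomog1.
by rewrite !big_cons; apply: bihomogM.
Qed.

Lemma bideg0 : bideg 0%MM = 0.
Proof. by rewrite /bideg !big1 // => i _; rewrite mnm0E. Qed.

Lemma bideg_sum (I : Type) (r : seq I) (F : I -> 'X_{1..(2 + 2)}) :
  bideg (\sum_(i <- r) F i)%MM = \sum_(i <- r) bideg (F i).
Proof.
elim: r => [|i r IHr]; last by rewrite !big_cons bidegD IHr.
by rewrite !big_nil bideg0.
Qed.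

Lemma bihomog_spec s L d p : bihomog d p -> bihomog d (spec s L p).
Proof.
move=> hp; rewrite [p]mpolyE big_seq rmorph_sum /=.
apply: (big_ind (bihomog d)); [exact: bihomog0 | exact: bihomogD |].
move=> m /hp <-; rewrite specZ; apply: bihomogZ.
have -> : bideg m = \sum_(i <- enum 'I_(2 + 2)) bideg U_(i) *+ m i.
  rewrite {1}[m]multinomUE_id -big_enum bideg_sum; apply: eq_bigr => i _.
  elim: (m i) => [|n IHn]; first by rewrite mulm0n bideg0.
  by rewrite mulmS bidegD IHn mulrS.
rewrite mpolyXE_id -big_enum rmorph_prod /=; apply: bihomog_prod => i.
rewrite rmorphXn /=; apply: bihomogXn.
have [s' [j ->]] := sideP i; rewrite bideg1.
have [->|] := eqVneq s' (~~ s); first by rewrite spec_Xn; apply: bihomog_var.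
have -> b b' : (b != ~~ b') = (b == b') by case: b b' => -[].
by move/eqP ->; rewrite spec_X; apply/bihomogZ/bihomog_var.
Qed.

Lemma phi_eq0 P p : phi P p = 0 ->
  exists u v, p = u * lineform false P.1 + v * lineform true P.2.
Proof.
move=> /spec_eq0 [u eu]; have [v ev] := spec_ker true P.2 p.
by exists u, v; rewrite -eu -ev addrC subrK.
Qed.

(** [phi] restricts to M first. Both orders kill the two equations of the point, and these generate
    the kernel of [phi]. *)
Lemma spec_comm_eq0 L M p : phi (L, M) p = 0 -> spec true M (spec false L p) = 0.
Proof.
case/phi_eq0 => u [v ->] /=.
rewrite rmorphD !rmorphM /= spec_lineform0 mulr0 add0r (spec_lineformn true) rmorphM /=.
by rewrite spec_lineform0 mulr0.
Qed.

(** No homogeneity of [q] is assumed: the leading monomial of a product is the product of the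
    leading monomials, and comparing their bidegrees is enough. *)
Lemma bideg_lprod_le s A (a b : nat) p q : bihomog (a%:Z, b%:Z) p -> p != 0 ->
  p = q * lprod s A -> (size A <= if s then b else a)%N.
Proof.
move=> hp p0 e; have q0 : q != 0.
  by apply: contraNneq p0 => q0; rewrite e q0 mul0r.
have := hp _ (mlead_supp p0); rewrite {1}e mleadM ?lprod_neq0 // bidegD.
rewrite (@bihomog_lprod k s A _ (mlead_supp (lprod_neq0 _ _))).
have -> : vdeg s *+ size A = if s then (0, (size A)%:Z) else ((size A)%:Z, 0).
  by rewrite -[in LHS](addr0 (vdeg s *+ _)); case: s {e};
   [have := vdegE 0 (size A) | have := vdegE (size A) 0]; rewrite mulr0n => ->;
   rewrite ?add0r ?addr0.
by case: s {e}; rewrite /bideg => -[]; lia.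
Qed.

(** The restriction to L is nonzero and vanishes at the points of L given by [A], so it is divisible
    by the product of their equations in the other factor. *)
Lemma restriction_degree s L A (a b : nat) p :
  bihomog (a%:Z, b%:Z) p -> uniq A -> spec s L p != 0 ->
  (forall M, M \in A -> phi (if s then (M, L) else (L, M)) p = 0) ->
  (size A <= if s then a else b)%N.
Proof.
move=> hp uA p0 pA; have hsp := bihomog_spec (s := s) (L := L) hp.
have [|q e] := @lprod_dvd _ (~~ s) A (spec s L p) uA.
  by move=> M /pA; case: s {p0 pA hsp} => // /spec_comm_eq0.
by have := bideg_lprod_le hsp p0 e; case: s {p0 pA hsp e}.
Qed.

End Substitution.

Section Transversality.
Local Open Scope ring_scope.
Variable k : closedFieldType.
Variables (X : {fset P1 k * P1 k}) (f g : cox k).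
Hypothesis fgX : cuts X f g.

(** If [f] and [g] both vanished on L, so would some [chart] power times [p]; but this restricts to
    a nonzero form. In the applications [p] is the product of the equations of the other projection
    of X. *)
Lemma cuts_not_both s L (a b : nat) p : bihomog (a%:Z, b%:Z) p -> ideal_of X p ->
  p != 0 -> spec s L p = p -> spec s L f = 0 -> spec s L g != 0.
Proof.
move=> hp pX p0 pL fL; apply/negP => /eqP gL.
case: fgX => _ _ /(_ _ _ _ hp pX (piv L) (piv L)) [N [u [v e]]].
have /eqP := congr1 (spec s L) e; rewrite rmorphD !rmorphM /= fL gL !mulr0 addr0.
rewrite pL rmorphXn /= rmorphM /= mulf_eq0 (negPf p0) orbF expf_eq0.
case: s {pL fL gL} => /=; rewrite spec_piv.
  by rewrite (spec_Xn true) (negPf (chart_neq0 _ _ _)) andbF.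
by rewrite (spec_Xs true) (negPf (chart_neq0 _ _ _)) andbF.
Qed.

(* Let l and m be the equations of L and M. If f = f2 l m, then near (L, M) the
   form l is u f + v g; if moreover g does not vanish on L, then v = v1 l, and
   dividing by l shows that 1 lies in the ideal (m, g) of the point. *)
Lemma cuts_transversal L M : (L, M) \in X ->
  spec false L f = 0 -> spec true M f = 0 -> spec false L g = 0.
Proof.
move=> PX fL fM; apply: contraTeq isT => gL.
have [f1 ef1] := spec_eq0 fL.
have [f2 ef2] : exists f2, f1 = f2 * lineform true M.
  apply: spec_eq0; apply/eqP; have /eqP := fM.
  by rewrite ef1 rmorphM /= (spec_lineformn false) mulf_eq0 (negPf (lineform_neq0 _ _)) orbF.
(* The equation l alone need not be in I_X; it is multiplied by the equations of the other first
   coordinates, which do not vanish at (L, M). *)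
pose A := [seq L' <- proj_fst X | L' != L].
have FX : ideal_of X (lprod false (L :: A)).
  apply/ideal_ofP => Q QX; rewrite phi_lprodx; apply: spec_lprod0.
  rewrite in_cons mem_filter; case: eqVneq => //= _.
  by apply/imfsetP; exists Q.
have hF' : bihomog ((size (L :: A))%:Z, 0%:Z) (lprod false (L :: A)).
  by rewrite vdegE mulr0n addr0; apply: bihomog_lprod.
case: fgX => _ gX /(_ _ _ _ hF' FX (piv L) (piv M)) [N [u [v e]]].
have [v1 ev] : exists v1, v = v1 * lineform false L.
  apply: spec_eq0; apply/eqP; have /eqP := congr1 (spec false L) e.
  rewrite rmorphD !rmorphM /= fL mulr0 add0r spec_lprod0 ?mem_head // mulr0.
  by rewrite eq_sym mulf_eq0 (negPf gL) orbF.
have e1 : chart k (piv L) (piv M) ^+ N * lprod false A = u * f2 * lineform true M + v1 * g.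
  apply: (mulIf (lineform_neq0 false L)).
  transitivity (chart k (piv L) (piv M) ^+ N * lprod false (L :: A)).
    by rewrite lprod_cons; ring.
  by rewrite e ev ef1 ef2; ring.
have := congr1 (phi (L, M)) e1; rewrite rmorphD !rmorphM rmorphXn /=.
rewrite (phi_chart (L, M)) (iffLR (ideal_ofP _ _) gX _ PX) mulr0 addr0.
rewrite [phi _ (lineform _ _)]phiE spec_lineform0 rmorph0 mulr0 phi_lprodx => /eqP.
rewrite mulf_eq0 expf_eq0 (negPf (chart_neq0 _ _ _)) andbF /=.
by rewrite (negPf (spec_lprod_neq0 _ _)) // mem_filter eqxx.
Qed.

End Transversality.

(** * The Bezout bound *)

Section Forms.
Local Open Scope ring_scope.
Variable k : fieldType.
Implicit Types (p q f g : cox k) (i j : nat).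

(** The exponents of x_0^r x_1^(i-r) y_0^t y_1^(j-t). These monomials form a basis of S_(i,j), which
    identifies it with a space of matrices and gives its dimension. *)
Definition bimon i j (r : 'I_i.+1) (t : 'I_j.+1) : 'X_{1..(2 + 2)} :=
  [multinom match split n with
            | inl n' => if n' == 0%R then r : nat else (i - r)%N
            | inr n' => if n' == 0%R then t : nat else (j - t)%N
            end | n < 2 + 2].

Lemma bimonE i j (r : 'I_i.+1) (t : 'I_j.+1) s n :
  bimon r t (side s n) = if s then (if n == 0%R then t : nat else (j - t)%N)
                       else (if n == 0%R then r : nat else (i - r)%N).
Proof.
by rewrite mnmE /side; case: s; rewrite ?(unsplitK (inl n)) ?(unsplitK (inr n)).
Qed.

Lemma bidegE (m : 'X_{1..(2 + 2)}) :
  bideg m = ((m (side false 0%R) + m (side false 1%R))%N%:Z,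
             (m (side true 0%R) + m (side true 1%R))%N%:Z).
Proof.
rewrite /bideg !big_ord_recl !big_ord0 !addn0.
by congr (Posz (_ + m _)%N, Posz (_ + m _)%N); apply: val_inj.
Qed.

Lemma bideg_bimon i j (r : 'I_i.+1) (t : 'I_j.+1) : bideg (bimon r t) = (i%:Z, j%:Z).
Proof. by rewrite bidegE !bimonE /= !subnKC // -ltnS. Qed.

Lemma bimonP i j m : bideg m = (i%:Z, j%:Z) ->
  exists (r : 'I_i.+1) (t : 'I_j.+1), m = bimon r t.
Proof.
rewrite bidegE => -[ei ej].
have lr : (m (side false 0%R) < i.+1)%N by rewrite ltnS -ei leq_addr.
have lt : (m (side true 0%R) < j.+1)%N by rewrite ltnS -ej leq_addr.
exists (Ordinal lr), (Ordinal lt); apply/mnmP => n.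
have [s [n' ->]] := sideP n; rewrite bimonE.
by case: (ord2P n') => ->; case: s => //=; rewrite -?ei -?ej addKn.
Qed.

Lemma bimon_inj i j (r r' : 'I_i.+1) (t t' : 'I_j.+1) :
  (bimon r t == bimon r' t') = (r == r') && (t == t').
Proof.
apply/eqP/andP => [/mnmP e|[/eqP-> /eqP-> //]].
split; apply/eqP/val_inj.
  by have := e (side false 0%R); rewrite !bimonE.
by have := e (side true 0%R); rewrite !bimonE.
Qed.

Definition mxform i j (M : 'M[k]_(i.+1, j.+1)) : cox k :=
  \sum_r \sum_t M r t *: 'X_[bimon r t].

Definition coefmx i j p : 'M[k]_(i.+1, j.+1) := \matrix_(r, t) p@_(bimon r t).

Lemma mcoeff_mxform i j (M : 'M[k]_(i.+1, j.+1)) r t : (mxform M)@_(bimon r t) = M r t.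
Proof.
rewrite /mxform raddf_sum (bigD1 r) //= raddf_sum (bigD1 t) //=.
rewrite mcoeffZ mcoeffX eqxx mulr1 !big1 ?addr0 // => [r' rr'|t' tt'].
  rewrite raddf_sum big1 //= => t' _.
  by rewrite mcoeffZ mcoeffX bimon_inj (negPf rr') mulr0.
by rewrite mcoeffZ mcoeffX bimon_inj (negPf tt') andbF mulr0.
Qed.

Lemma mxformK i j (M : 'M[k]_(i.+1, j.+1)) : coefmx i j (mxform M) = M.
Proof. by apply/matrixP => r t; rewrite mxE mcoeff_mxform. Qed.

Lemma bihomog_mxform i j (M : 'M[k]_(i.+1, j.+1)) : bihomog (i%:Z, j%:Z) (mxform M).
Proof.
apply: (big_ind (bihomog _)); [exact: bihomog0 | exact: bihomogD | move=> r _].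
apply: (big_ind (bihomog _)); [exact: bihomog0 | exact: bihomogD | move=> t _].
by apply: bihomogZ; rewrite -(bideg_bimon r t); apply: bihomogX.
Qed.

Lemma coefmxK i j p : bihomog (i%:Z, j%:Z) p -> mxform (coefmx i j p) = p.
Proof.
move=> hp; apply/mpolyP => m; have [dm|dm] := eqVneq (bideg m) (i%:Z, j%:Z).
  by have [r [t ->]] := bimonP dm; rewrite mcoeff_mxform mxE.
have z q : bihomog (i%:Z, j%:Z) q -> q@_m = 0.
  by move=> hq; apply: memN_msupp_eq0; apply: contra dm => /hq ->.
by rewrite !z //; apply: bihomog_mxform.
Qed.

Lemma mxform_is_linear i j : linear (@mxform i j).
Proof.
move=> c M N; rewrite /mxform scaler_sumr -big_split; apply: eq_bigr => r _ /=.
rewrite scaler_sumr -big_split; apply: eq_bigr => t _ /=.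
by rewrite !mxE scalerDl scalerA.
Qed.
HB.instance Definition _ i j :=
  GRing.isLinear.Build k 'M[k]_(i.+1, j.+1) (cox k) _ (@mxform i j)
    (@mxform_is_linear i j).

Lemma coefmx_is_linear i j : linear (@coefmx i j).
Proof. by move=> c p q; apply/matrixP => r t; rewrite !mxE mcoeffD mcoeffZ. Qed.
HB.instance Definition _ i j :=
  GRing.isLinear.Build k (cox k) 'M[k]_(i.+1, j.+1) _ (@coefmx i j)
    (@coefmx_is_linear i j).

Lemma coefmx_other i j d p : bihomog d p -> d != (i%:Z, j%:Z) -> coefmx i j p = 0.
Proof.
move=> hp dij; apply/matrixP => r t; rewrite !mxE; apply: memN_msupp_eq0.
by apply: contra dij => /hp <-; rewrite bideg_bimon.
Qed.

(** [coefmx] reads off one bihomogeneous component of any polynomial; as [f] is bihomogeneous, a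
    component of p f depends on a single component of [p]. *)
Lemma coefmxM i j a b f p : bihomog (a%:Z, b%:Z) f ->
  coefmx (i + a) (j + b) (p * f) = coefmx (i + a) (j + b) (mxform (coefmx i j p) * f).
Proof.
move=> hf; elim/mpolyind: p => [|c m p _ _ IHp]; first by rewrite !linear0 !mul0r.
rewrite !(mulrDl, linearD) /= IHp; congr (_ + _).
rewrite !linearZ /= -!scalerAl !linearZ /=; congr (_ *: _).
have hm := @bihomogX k m.
have [dm|dm] := eqVneq (bideg m) (i%:Z, j%:Z).
  by rewrite coefmxK // -dm.
rewrite (coefmx_other hm dm) linear0 mul0r linear0.
apply: coefmx_other (bihomogM hm hf) _; apply: contra dm => /eqP e; apply/eqP.
by apply: (addIr (a%:Z, b%:Z)); rewrite e !PoszD.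
Qed.

Lemma mxform_coefmxM i j i' j' a b f p : bihomog (a%:Z, b%:Z) f ->
  i = (i' + a)%N -> j = (j' + b)%N ->
  mxform (coefmx i j (p * f)) = mxform (coefmx i' j' p) * f.
Proof.
move=> hf -> ->; rewrite coefmxM // coefmxK //.
by have := bihomogM (@bihomog_mxform _ _ (coefmx i' j' p)) hf; rewrite !PoszD.
Qed.

(** Arbitrary cofactors are replaced by their components of the right bidegrees. *)
Lemma ideal2_homog f g (a b c d i j i' j' i'' j'' : nat) p :
  bihomog (a%:Z, b%:Z) f -> bihomog (c%:Z, d%:Z) g -> bihomog (i%:Z, j%:Z) p ->
  i = (i' + a)%N -> j = (j' + b)%N -> i = (i'' + c)%N -> j = (j'' + d)%N ->
  ideal2 f g p -> exists (u : 'M_(i'.+1, j'.+1)) (v : 'M_(i''.+1, j''.+1)),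
    p = mxform u * f + mxform v * g.
Proof.
move=> hf hg hp ei ej ei' ej' [u [v e]]; exists (coefmx i' j' u), (coefmx i'' j'' v).
by rewrite -(coefmxK hp) e !linearD /= (mxform_coefmxM _ hf ei ej) (mxform_coefmxM _ hg ei' ej').
Qed.

End Forms.

Section Evaluation.
Local Open Scope ring_scope.
Variable k : fieldType.
Implicit Types (p q f g : cox k) (i j : nat) (P : P1 k * P1 k).

Definition ncoords P (n : 'I_(2 + 2)) : k :=
  match split n with inl i => ncoord P.1 i | inr i => ncoord P.2 i end.

Lemma phi_var P s n : phi P 'X_(side s n) = ncoords P (side s n) *: pvar P s.
Proof.
rewrite phiE /ncoords /pvar /side; case: s.
  rewrite (unsplitK (inr n)) -/(side true n) spec_X specZ.
  by rewrite -/(side true _) (spec_Xn false).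
by rewrite (unsplitK (inl n)) -/(side false n) (spec_Xn true) spec_X.
Qed.

(** For forms of a fixed bidegree, vanishing at P thus becomes one linear condition, the vanishing
    of the value at the normalized representative. *)
Lemma phi_homog P i j p : bihomog (i%:Z, j%:Z) p ->
  phi P p = p.@[ncoords P] *: (pvar P false ^+ i * pvar P true ^+ j).
Proof.
move=> hp; rewrite {1 2}[p]mpolyE rmorph_sum raddf_sum /= scaler_suml.
apply: eq_big_seq => m /hp em; rewrite mevalZ -mul_mpolyC rmorphM /=.
have -> : phi P (p@_m)%:MP = (p@_m)%:MP.
  by rewrite /phi -[_%:MP]mulr1 mul_mpolyC !specZ !rmorph1.
rewrite mul_mpolyC -scalerA; congr (_ *: _).
rewrite mpolyXE_id rmorph_prod rmorph_prod /=.
pose v (n : 'I_(2 + 2)) := pvar P (if split n is inl _ then false else true).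
rewrite (eq_bigr (fun n => ncoords P n ^+ m n *: v n ^+ m n)).
  rewrite scaler_prod; congr (_ *: _).
    by apply: eq_bigr => n _; rewrite rmorphXn /= mevalXU.
  rewrite big_split_ord /= [X in X * _](_ : _ = pvar P false ^+ i).
    rewrite [X in _ * X](_ : _ = pvar P true ^+ j) //.
    case: em => _ <-; rewrite expr_sum; apply: eq_bigr => n _.
    by rewrite /v (unsplitK (inr n)).
  case: em => <- _; rewrite expr_sum; apply: eq_bigr => n _.
  by rewrite /v (unsplitK (inl n)).
move=> n _; rewrite rmorphXn /= /v.
have [s [n' ->]] := sideP n; rewrite phi_var exprZn; congr (_ *: pvar _ _ ^+ _).
by rewrite /side; case: s; rewrite ?(unsplitK (inr _)) ?(unsplitK (inl _)).
Qed.

Lemma phi_homog_eq0 P i j p : bihomog (i%:Z, j%:Z) p ->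
  phi P p = 0 <-> p.@[ncoords P] = 0.
Proof.
move=> hp; rewrite (phi_homog P hp); split=> [/eqP|->]; last by rewrite scale0r.
rewrite scaler_eq0 => /orP[/eqP //|].
by rewrite mulf_eq0 !expf_eq0 !(negPf (pvar_neq0 _ _)) !andbF.
Qed.

End Evaluation.

Section LinearAlgebra.
Local Open Scope ring_scope.

(** Rank-nullity along W -> U -> V -> Z: dim V is at most dim Z + rank T, and rank T is at most dim
    U - dim W. *)
Lemma complex_dim_le (F : fieldType) (W U V Z : vectType F)
    (K : {linear W -> U}) (T : {linear U -> V}) (E : {linear V -> Z}) :
  injective K -> (forall w, T (K w) = 0) ->
  (forall v, E v = 0 -> exists u, T u = v) ->
  (dim V + dim W <= dim U + dim Z)%N.
Proof.
move=> Kinj TK ET.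
have eV := limg_ker_dim (linfun E) fullv; have eU := limg_ker_dim (linfun T) fullv.
have eW := limg_ker_dim (linfun K) fullv.
rewrite !capfv !dimvf in eV eU eW.
have kK : \dim (lker (linfun K)) = 0%N.
  apply/eqP; rewrite dimv_eq0 -subv0; apply/subvP => w.
  by rewrite memv_ker lfunE memv0 /= -(linear0 K) => /eqP/Kinj ->.
have le1 : (\dim (limg (linfun K)) <= \dim (lker (linfun T)))%N.
  apply/dimvS/subvP => _ /memv_imgP [w _ ->].
  by rewrite memv_ker !lfunE /= TK.
have le2 : (\dim (lker (linfun E)) <= \dim (limg (linfun T)))%N.
  apply/dimvS/subvP => v; rewrite memv_ker lfunE /= => /eqP/ET [u <-].
  by apply/memv_imgP; exists u; rewrite ?memvf ?lfunE.
have le3 : (\dim (limg (linfun E)) <= dim Z)%N.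
  by rewrite -dimvf; apply/dimvS/subvf.
by lia.
Qed.

End LinearAlgebra.

(** * The ideal of the points in large bidegrees *)

Section LargeDegrees.
Local Open Scope ring_scope.
Variable k : closedFieldType.
Variables (X : {fset P1 k * P1 k}) (f g : cox k).
Hypothesis fgX : cuts X f g.
Implicit Types (p q : cox k).

Lemma cuts_uniform (a b : nat) p : bihomog (a%:Z, b%:Z) p -> ideal_of X p ->
  exists N, forall r s, ideal2 f g (chart k r s ^+ N * p).
Proof.
move=> hp pX; case: fgX => _ _ /(_ _ _ _ hp pX) H.
have [N00 H00] := H 0 0; have [N01 H01] := H 0 1.
have [N10 H10] := H 1 0; have [N11 H11] := H 1 1.
have up r s N N' : (N <= N')%N -> ideal2 f g (chart k r s ^+ N * p) ->
    ideal2 f g (chart k r s ^+ N' * p).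
  by move=> le; rewrite -(subnK le) exprD -mulrA; apply: ideal2M.
exists (N00 + N01 + N10 + N11)%N => r s.
by case: (ord2P r) => ->; case: (ord2P s) => ->;
   [apply: up H00 | apply: up H01 | apply: up H10 | apply: up H11]; lia.
Qed.

(** Let N serve for all four charts. A monomial of bidegree at least (2N, 2N) has an x and a y of
    exponent at least N, so it is divisible by the N-th power of a chart form. *)
Lemma cuts_big (a b : nat) p : bihomog (a%:Z, b%:Z) p -> ideal_of X p ->
  exists N, forall (i j : nat) u, (N <= i)%N -> (N <= j)%N ->
    bihomog (i%:Z, j%:Z) u -> ideal2 f g (u * p).
Proof.
move=> hp pX; have [N HN] := cuts_uniform hp pX; exists (N + N)%N => i j u Ni Nj hu.
rewrite [u]mpolyE mulr_suml big_seq; apply: (big_ind (ideal2 f g)).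
- exact: ideal2_0.
- exact: ideal2D.
move=> m /hu; rewrite bidegE => -[e1 e2].
have pick (x y : nat) : (N + N <= x + y -> N <= x \/ N <= y)%N by lia.
have [r lr] : exists r, (N <= m (side false r))%N.
  by have [] := pick _ _ (leq_trans Ni (eq_leq (esym e1))); [exists 0 | exists 1].
have [s ls] : exists s, (N <= m (side true s))%N.
  by have [] := pick _ _ (leq_trans Nj (eq_leq (esym e2))); [exists 0 | exists 1].
have le : ((U_(side false r) + U_(side true s)) *+ N <= m)%MM.
  apply/mnm_lepP => n; rewrite mulmnE mnmDE !mnm1E.
  have [t [n' ->]] := sideP n; rewrite !side_eq.
  by case: t => /=; case: eqVneq => [<-|_]; rewrite ?mul0n ?mul1n.
rewrite -(submK le) mpolyXD -mpolyXn mpolyXD -scalerAl -mulrA scalerAl.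
exact/ideal2M/HN.
Qed.

Let A := proj_fst X.
Let B := proj_snd X.

Lemma mem_proj P : P \in X -> P.1 \in A /\ P.2 \in B.
Proof. by move=> PX; split; apply/imfsetP; exists P. Qed.

Lemma bihomog_lprod_nat s (C : seq (P1 k)) :
  bihomog (if s then 0%:Z else (size C)%:Z, if s then (size C)%:Z else 0%:Z) (lprod s C).
Proof.
by have := @bihomog_lprod k s C; case: s => /=; rewrite vdegE mulr0n ?add0r ?addr0.
Qed.

(* Induction on the missing points: a Lagrange interpolation form at such a
   point lies in the ideal of X, so it can be used to kill the value there. *)
Lemma cuts_large_avoiding (s : seq (P1 k * P1 k)) : (forall P, P \in s -> P \notin X) ->
  exists N, forall (i j : nat) p, (N <= i)%N -> (N <= j)%N -> bihomog (i%:Z, j%:Z) p ->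
    (forall P, P.1 \in A -> P.2 \in B -> P \notin s -> phi P p = 0) -> ideal2 f g p.
Proof.
elim: s => [|Q s IHs] sX.
  (* Here [p] vanishes on the whole grid, so it is a combination of the two products of equations;
     both of these lie in I_X, and their cofactors have large bidegrees. *)
  have hF : bihomog ((size A)%:Z, 0%:Z) (lprod false A) := @bihomog_lprod_nat false A.
  have hG : bihomog (0%:Z, (size B)%:Z) (lprod true B) := @bihomog_lprod_nat true B.
  have [|N1 H1] := cuts_big hF.
    by apply/ideal_ofP => P /mem_proj [PA _]; rewrite phi_lprodx; apply: spec_lprod0.
  have [|N2 H2] := cuts_big hG.
    by apply/ideal_ofP => P /mem_proj [_ PB]; rewrite phi_lprody; apply: spec_lprod0.
  exists (N1 + N2 + size A + size B)%N => i j p Ni Nj hp pAB.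
  have pFG : ideal2 (lprod false A) (lprod true B) p.
    by apply: grid_ideal; rewrite ?fset_uniq // => L M LA MB; apply: pAB.
  have [] := @ideal2_homog _ _ _ _ _ _ _ i j (i - size A) j i (j - size B) p
    hF hG hp _ _ _ _ pFG; try lia.
  move=> u [v ->]; apply: ideal2D.
    by apply: (H1 _ _ _ _ _ (@bihomog_mxform _ _ _ u)); lia.
  by apply: (H2 _ _ _ _ _ (@bihomog_mxform _ _ _ v)); lia.
have [|N1 H1] := IHs; first by move=> P Ps; apply: sX; rewrite in_cons Ps orbT.
(* The form [e] below is the interpolation form: it vanishes at the grid points other than Q but not
   at Q. *)
pose A' := [seq L <- A | L != Q.1]; pose B' := [seq M <- B | M != Q.2].
pose e := lprod false A' * lprod true B'.
have he : bihomog ((size A')%:Z, (size B')%:Z) e.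
  have := bihomogM (@bihomog_lprod_nat false A') (@bihomog_lprod_nat true B').
  by congr bihomog; congr (_, _); rewrite ?add0r ?addr0.
have e0 P : P.1 \in A -> P.2 \in B -> P != Q -> phi P e = 0.
  move=> PA PB PQ.
  have -> : phi P e = spec false P.1 (lprod false A') * spec true P.2 (lprod true B').
    by rewrite -phi_lprodx -phi_lprody -rmorphM.
  have [e1|ne1] := eqVneq P.1 Q.1.
    have -> : spec true P.2 (lprod true B') = 0.
      apply: spec_lprod0; rewrite mem_filter PB andbT; apply: contra PQ => /eqP e2.
      by rewrite [P]surjective_pairing e1 e2 -surjective_pairing.
    by rewrite mulr0.
  by rewrite spec_lprod0 ?mul0r // mem_filter ne1.
have eQ : phi Q e != 0.
  rewrite /e rmorphM /=; apply: mulf_neq0.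
    by rewrite phi_lprodx; apply: spec_lprod_neq0; rewrite mem_filter eqxx.
  by rewrite phi_lprody; apply: spec_lprod_neq0; rewrite mem_filter eqxx.
have eX : ideal_of X e.
  apply/ideal_ofP => P PX; have [PA PB] := mem_proj PX; apply: e0 => //.
  by apply: contraTneq PX => ->; apply: sX; rewrite mem_head.
have [N2 H2] := cuts_big he eX.
exists (N1 + N2 + size A' + size B')%N => i j p Ni Nj hp ps.
have arith a b n1 n2 n : (n1 + n2 + a + b <= n ->
    [/\ a <= n, b <= n, n1 <= n, n2 <= n - a & n2 <= n - b])%N by move=> le; split; lia.
have [iA _ i1 i2 _] := arith _ _ _ _ _ Ni; have [_ jB j1 _ j2] := arith _ _ _ _ _ Nj.
(* A monomial that does not vanish at Q, raising [e] to bidegree (i, j). *)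
pose q := pvar Q false ^+ (i - size A') * pvar Q true ^+ (j - size B').
have hq : bihomog ((i - size A')%N%:Z, (j - size B')%N%:Z) q.
  by rewrite vdegE; apply: bihomogM; apply: bihomogXn; apply: bihomog_var.
have hqe : bihomog (i%:Z, j%:Z) (q * e).
  by have := bihomogM hq he; congr bihomog; congr (_, _); rewrite /= -PoszD subnK.
have qQ : phi Q q = q.
  by rewrite /q rmorphM; congr (_ * _); rewrite rmorphXn; congr (_ ^+ _); apply: phi_pvar.
have q0 : phi Q q != 0.
  by rewrite qQ; apply: mulf_neq0; apply: expf_neq0; apply: pvar_neq0.
have qeQ : (q * e).@[ncoords Q] != 0.
  apply/eqP => /(phi_homog_eq0 Q hqe) qe0.
  have /eqP[] : phi Q (q * e) != 0 by rewrite rmorphM; apply: mulf_neq0 q0 eQ.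
  exact: qe0.
pose c := p.@[ncoords Q] / (q * e).@[ncoords Q].
rewrite -[p](subrK (c *: (q * e))); apply: ideal2D; last first.
  by rewrite scalerAl; apply: (H2 _ _ _ _ _ (bihomogZ (c := c) hq)).
have hr : bihomog (i%:Z, j%:Z) (p - c *: (q * e)) by apply/bihomogB/bihomogZ.
apply: (H1 _ _ _ _ _ hr) => // P PA PB Ps.
have [->|PQ] := eqVneq P Q.
  by apply/(phi_homog_eq0 Q hr); rewrite mevalB mevalZ divfK ?subrr.
have z : phi P (q * e) = 0.
  transitivity (phi P q * phi P e); first exact: rmorphM.
  by rewrite e0 // mulr0.
by rewrite rmorphB /= phiZ z ps ?in_cons ?negb_or ?PQ // scaler0 subrr.
Qed.

Lemma cuts_large : exists N, forall (i j : nat) p, (N <= i)%N -> (N <= j)%N ->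
  bihomog (i%:Z, j%:Z) p -> ideal_of X p -> ideal2 f g p.
Proof.
have [|N H] := @cuts_large_avoiding [seq P <- (A `*` B)%fset | P \notin X].
  by move=> P; rewrite mem_filter => /andP[].
exists N => i j p Ni Nj hp pX; apply: (H i j) => // P PA PB.
rewrite mem_filter negb_and negbK => /orP[PX|].
  exact: (iffLR (ideal_ofP _ _) pX).
by rewrite inE PA PB.
Qed.

End LargeDegrees.

(** * Dimension count in the Koszul complex *)

Lemma dim_pair (F : fieldType) (U V : vectType F) :
  dim (U * V)%type = (dim U + dim V)%N.
Proof. by []. Qed.

Section Bezout.
Local Open Scope ring_scope.
Variable k : closedFieldType.
Variables (X : {fset P1 k * P1 k}) (f g : cox k).
Hypothesis fgX : cuts X f g.

(* In a large bidegree D, the Koszul complex bounds from below the codimension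
   of (f, g)_D = (I_X)_D in S_D, and this codimension is at most the number of
   conditions imposed by the points. *)
Lemma bezout_le (a b c d : nat) : bihomog (a%:Z, b%:Z) f -> bihomog (c%:Z, d%:Z) g ->
  f != 0 -> (a * d + b * c <= #|` X|)%N.
Proof.
move=> hf hg f0; have [e large] := cuts_large fgX.
(* [K] and [T] are the Koszul maps ending in bidegree (a+c+e, b+d+e), and [E] evaluates at the
   points of X. This bidegree is large, so [cuts_large] gives exactness at the target of [T]. *)
pose T (uv : 'M[k]_((c + e).+1, (d + e).+1) * 'M[k]_((a + e).+1, (b + e).+1)) :=
  coefmx (a + c + e) (b + d + e) (mxform uv.1 * f + mxform uv.2 * g).
pose K (w : 'M[k]_(e.+1, e.+1)) :=
  (coefmx (c + e) (d + e) (mxform w * g), - coefmx (a + e) (b + e) (mxform w * f)).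
pose E (M : 'M[k]_((a + c + e).+1, (b + d + e).+1)) : 'rV[k]_(size X) :=
  \row_n (mxform M).@[ncoords (tnth (in_tuple X) n)].
have T_lin : linear T.
  move=> x u v; rewrite /T -linearP; congr coefmx.
  by rewrite !(linearP (@mxform k _ _)) !mulrDl -!scalerAl scalerDr addrACA.
have K_lin : linear K.
  move=> x u v; rewrite /K.
  have lin q i j :
      coefmx i j (mxform (x *: u + v) * q) =
        x *: coefmx i j (mxform u * q) + coefmx i j (mxform v * q).
    by rewrite (linearP (@mxform k _ _)) mulrDl -scalerAl linearP.
  by rewrite !lin; congr (_, _); rewrite opprD -scalerN.
have E_lin : linear E.
  by move=> x u v; apply/rowP => n; rewrite !mxE linearP mevalD mevalZ.
pose TL : {linear _ -> _} := HB.pack T (GRing.isLinear.Build _ _ _ _ T T_lin).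
pose KL : {linear _ -> _} := HB.pack K (GRing.isLinear.Build _ _ _ _ K K_lin).
pose EL : {linear _ -> _} := HB.pack E (GRing.isLinear.Build _ _ _ _ E E_lin).
have mkf (w : 'M[k]_(e.+1, e.+1)) :
    mxform (coefmx (a + e) (b + e) (mxform w * f)) = mxform w * f.
  by rewrite (mxform_coefmxM (i' := e) (j' := e) _ hf) ?mxformK // addnC.
have mkg (w : 'M[k]_(e.+1, e.+1)) :
    mxform (coefmx (c + e) (d + e) (mxform w * g)) = mxform w * g.
  by rewrite (mxform_coefmxM (i' := e) (j' := e) _ hg) ?mxformK // addnC.
have K_inj : injective KL.
  move=> w w' /(congr1 snd) /= /oppr_inj /(congr1 (@mxform _ _ _)).
  by rewrite !mkf => /(mulIf f0) /(congr1 (@coefmx _ e e)); rewrite !mxformK.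
have TK w : TL (KL w) = 0.
  by rewrite /= /T /K /= linearN /= mkf mkg mulNr mulrAC subrr linear0.
have ET M : EL M = 0 -> exists uv, TL uv = M.
  move=> /= /rowP EM; have hM := @bihomog_mxform k _ _ M.
  have MX : ideal_of X (mxform M).
    apply/ideal_ofP => P PX; apply/(phi_homog_eq0 P hM).
    have /tnthP [n ->] : P \in in_tuple X by [].
    by have := EM n; rewrite !mxE.
  have [] := @ideal2_homog k f g a b c d _ _ (c + e) (d + e) (a + e) (b + e) _ hf hg hM;
    try lia.
    by apply: large hM MX; lia.
  by move=> u [v eM]; exists (u, v); rewrite /= /T /= -eM mxformK.
(* In the alternating sum of the dimensions everything cancels except ad + bc. *)
have arith n : ((a + c + e).+1 * (b + d + e).+1 + e.+1 * e.+1 <=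
    (c + e).+1 * (d + e).+1 + (a + e).+1 * (b + e).+1 + 1 * n -> a * d + b * c <= n)%N.
  by nia.
by have := complex_dim_le K_inj TK ET; rewrite dim_pair !dim_matrix => /arith.
Qed.

End Bezout.

(** * Crosses and Ferrers diagrams *)

Section Main.
Variable k : closedFieldType.

(** What a Ferrers diagram supplies is a cross: a line in each direction all of whose grid points
    lie in X. *)
Lemma cuts_cross_rectangle (X : {fset P1 k * P1 k}) f g df dg (L M : P1 k) :
  cuts X f g -> bihomog df f -> bihomog dg g ->
  L \in proj_fst X ->
  (forall L', L' \in proj_fst X -> (L', M) \in X) ->
  (forall M', M' \in proj_snd X -> (L, M') \in X) -> rectangle X.
Proof.
move=> fgX hf hg LA rowM colL; pose A := proj_fst X; pose B := proj_snd X.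
have gfX := cuts_sym fgX.
have PX : (L, M) \in X by apply: rowM.
have hF : bihomog (Posz (size A), Posz 0) (lprod false A) := @bihomog_lprod_nat k false A.
have hG : bihomog (Posz 0, Posz (size B)) (lprod true B) := @bihomog_lprod_nat k true B.
have FX : ideal_of X (lprod false A).
  by apply/ideal_ofP => P /mem_proj [PA _]; rewrite phi_lprodx; apply: spec_lprod0.
have GX : ideal_of X (lprod true B).
  by apply/ideal_ofP => P /mem_proj [_ PB]; rewrite phi_lprody; apply: spec_lprod0.
have nL u v : cuts X u v -> spec false L u = 0%R -> spec false L v != 0%R.
  move=> uvX; apply: (cuts_not_both uvX hG GX (lprod_neq0 _ _)).
  exact: (spec_lprodn true).
have nM u v : cuts X u v -> spec true M u = 0%R -> spec true M v != 0%R.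
  move=> uvX; apply: (cuts_not_both uvX hF FX (lprod_neq0 _ _)).
  exact: (spec_lprodn false).
have nLM u v : cuts X u v -> spec false L u = 0%R -> spec true M u != 0%R.
  move=> uvX uL; apply/eqP => uM; have := nL _ _ uvX uL.
  by rewrite (cuts_transversal uvX PX uL uM) eqxx.
have n0 u v : cuts X u v -> u != 0%R.
  move=> uvX; apply/eqP => u0; have := nLM _ _ uvX.
  by rewrite u0 !rmorph0 eqxx => /(_ erefl).
have f0 := n0 _ _ fgX; have g0 := n0 _ _ gfX.
have [a [b e]] := bihomog_nat f0 hf; rewrite {}e in hf.
have [c [d e]] := bihomog_nat g0 hg; rewrite {}e in hg.
have degL u v i j : cuts X u v -> bihomog (Posz i, Posz j) u -> spec false L u != 0%R ->
    size B <= j.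
  case=> uX _ _ hu u0; apply: (restriction_degree hu _ u0) => [|M' M'B].
    exact: fset_uniq.
  by apply: (iffLR (ideal_ofP _ _) uX); apply: colL.
have degM u v i j : cuts X u v -> bihomog (Posz i, Posz j) u -> spec true M u != 0%R ->
    size A <= i.
  case=> uX _ _ hu u0; apply: (restriction_degree hu _ u0) => [|L' L'A].
    exact: fset_uniq.
  by apply: (iffLR (ideal_ofP _ _) uX); apply: rowM.
have le : size A * size B <= #|` X|.
  apply: leq_trans (bezout_le fgX hf hg f0).
  (* If [f] vanishes on L, or [g] on M, then [f] is nonzero on M and [g] on L, which bounds |A| |B|
     by ad. Otherwise [f] is nonzero on L and [g] on M, which bounds it by bc. *)
  have [fL|fL] := eqVneq (spec false L f) 0%R.
    apply: leq_trans (leq_mul _ _) (leq_addr _ _).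
      exact: degM fgX hf (nLM _ _ fgX fL).
    exact: degL gfX hg (nL _ _ fgX fL).
  have bB := degL _ _ _ _ fgX hf fL.
  have [gM|gM] := eqVneq (spec true M g) 0%R.
    have gL : spec false L g != 0%R.
      by apply: contraTneq isT => gL; have := nLM _ _ gfX gL; rewrite gM eqxx.
    apply: leq_trans (leq_mul _ _) (leq_addr _ _).
      exact: degM fgX hf (nM _ _ gfX gM).
    exact: degL gfX hg gL.
  rewrite mulnC; apply: leq_trans (leq_mul bB _) (leq_addl _ _).
  exact: degM gfX hg gM.
apply/eqP; rewrite eqEfcard; apply/andP; split.
  by apply/fsubsetP => P /mem_proj [PA PB]; rewrite inE PA PB.
apply: leq_trans le; rewrite -(size_allpairs pair) uniq_leq_size ?fset_uniq //.
move=> P; rewrite inE => /andP[PA PB].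
by apply/allpairsP; exists P; split; rewrite -?surjective_pairing.
Qed.

End Main.

Theorem corollary3p7 (k : closedFieldType) (X : {fset P1 k * P1 k})
    (X_neq0 : X != fset0) (X_ferrers : ferrers X) :
  virtual_complete_intersection X <-> rectangle X.
Proof.
split; last exact: rectangle_vci.
case=> f [g [df [dg [hf [hg [_ /vci_cuts fgX]]]]]].
case: X_ferrers => h [v [a [b [lam [[_ ea] [_ eb] lam_mono lam_ge1 inX]]]]].
have [P PX] := fset0Pn _ X_neq0.
have aP L : L \in proj_fst X -> exists i, L = tnth a i by rewrite -ea => /tnthP.
have bP M : M \in proj_snd X -> exists j, M = tnth b j by rewrite -eb => /tnthP.
have [PA PB] := mem_proj PX.
have [i0 _] := aP _ PA; have [j0 _] := bP _ PB.
have h0 : 0 < h by apply: leq_ltn_trans (ltn_ord i0).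
have v0 : 0 < v by apply: leq_ltn_trans (ltn_ord j0).
(* The first lines of the diagram form the cross: index 0 is below every [lam j], and [lam] is
   largest at index 0. *)
pose i1 := Ordinal h0; pose j1 := Ordinal v0.
apply: (@cuts_cross_rectangle k X f g df dg (tnth a i1) (tnth b j1) fgX hf hg).
- by rewrite -ea mem_tnth.
- move=> L /imfsetP[[L' M'] /= QX ->]; have [/= QA QB] := mem_proj QX.
  have [i ei] := aP _ QA; have [j ej] := bP _ QB; rewrite ei.
  by apply/inX; apply: leq_trans (lam_mono j1 j _) => //; apply/inX; rewrite -ei -ej.
- by move=> M /bP[j ->]; apply/inX; apply: lam_ge1.
Qed.
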